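(* Let $G$ and $H$ be two bi-orderable groups. Then the free product $G * H$ has no isolated bi-orderings. That is, for every bi-order $<$ on $G*H$ and every finite set $S\subset G*H$ of elements that are positive with respect to $<$, there exists a bi-order $\prec$ on $G*H$ with $\prec\,\neq\,<$ such that every element of $S$ is positive with respect to $\prec$.
   Context: A bi-order (or bi-ordering) on a group $K$ is a (strict) total order $<$ on $K$ that is invariant under left and right multiplication: $x<y$ implies $zx<zy$ and $xz<yz$ for all $x,y,z\in K$. A group is bi-orderable if it admits a bi-order. An element $k\in K$ is positive (with respect to $<$) if it is bigger than the identity element, $k>1$; the set of positive elements is denoted $P_<$. The set $\mathcal{BO}(K)$ of all bi-orders on $K$ is given the topology whose base consists of the sets $U_S=\{<\,\in\mathcal{BO}(K) : S\subset P_<\}$, for finite $S\subset K$. A bi-order $<$ is isolated if there is a finite set $S\subset K$ such that $<$ is the only bi-order on $K$ with $S\subset P_<$.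
   Formalization: Both groups G and H are assumed nontrivial; with a trivial factor the claim fails, e.g. for G = 1 and H = Z, where G * H = Z has exactly two bi-orders and both are isolated. *)

(* Defs.v *)
From HB Require Import structures.
From mathcomp Require Import all_boot.

Set Implicit Arguments.
Unset Strict Implicit.
Unset Printing Implicit Defensive.

Local Open Scope group_scope.

(* The free product of two groups G and H is realised by reduced words:       *)
(* finite sequences of non-identity letters taken alternately from G and H.   *)
(* free_prod_universal shows that it is the coproduct of G and H.             *)
Section Words.
Variables G H : groupType.
Implicit Types (a b c d : G + H) (u v w : seq (G + H)).

Definition is_inl a : bool := if a is inl _ then true else false.

Definition letter1 a : bool :=
  match a with inl x => x == 1 | inr y => y == 1 end.

Definition letterV a : G + H :=
  match a with inl x => inl x^-1 | inr y => inr y^-1 end.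

Definition letterM a b : option (G + H) :=
  match a, b with
  | inl x, inl x' => Some (inl (x * x'))
  | inr y, inr y' => Some (inr (y * y'))
  | _, _ => None
  end.

Definition alternating a b : bool := is_inl a != is_inl b.

Definition reduced w : bool := all (predC letter1) w && sorted alternating w.

(* The reduced form of a :: w, for a reduced word w; letters equal to the     *)
(* identity are dropped.                                                      *)
Definition lcons a w : seq (G + H) :=
  if letter1 a then w else
  if w is b :: w' then
    if letterM a b is Some c then (if letter1 c then w' else c :: w')
    else a :: w
  else [:: a].

Definition wmul u v : seq (G + H) := foldr lcons v u.

Definition winv w : seq (G + H) := rev (map letterV w).

Definition ocons a w : seq (G + H) := if letter1 a then w else a :: w.
Definition fresh a w : bool := if w is b :: _ then alternating a b else true.

Lemma reduced_cons a w :
  reduced (a :: w) = [&& ~~ letter1 a, fresh a w & reduced w].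
Proof.
rewrite /reduced; case: w => [|b w] /=; first by rewrite andbT.
by rewrite -!andbA; do !bool_congr.
Qed.

Lemma letterM_alt a b : (letterM a b == None) = alternating a b.
Proof. by case: a b => ? []. Qed.

Lemma letterM_side a b c : letterM a b = Some c -> is_inl c = is_inl b.
Proof. by case: a b => ? [] // ? [<-]. Qed.

Lemma letterM_eq a b :
  is_inl a = is_inl b -> exists c, letterM a b = Some c.
Proof. by case: a b => x [] y //= _; eexists. Qed.

Lemma letterMA a b c d e : letterM a b = Some c -> letterM b d = Some e ->
  letterM a e = letterM c d.
Proof. by case: a b d => x [] y // [] z //= [<-] [<-]; rewrite /= mulgA. Qed.

Lemma letter1M a b c : letterM a b = Some c -> letter1 a -> c = b.
Proof. by case: a b => x [] y //= [<-] /eqP->; rewrite mul1g. Qed.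

Lemma letterM1 a b c : letterM a b = Some c -> letter1 b -> c = a.
Proof. by case: a b => x [] y //= [<-] /eqP->; rewrite mulg1. Qed.

Lemma fresh_side a b w : is_inl a = is_inl b -> fresh a w = fresh b w.
Proof. by rewrite /fresh /alternating => ->. Qed.

Lemma lcons_fresh a w : fresh a w -> lcons a w = ocons a w.
Proof.
rewrite /lcons /ocons; case: ifP => // _; case: w => //= b w.
by rewrite -letterM_alt => /eqP->.
Qed.

Lemma lcons_ocons a b c w :
  letterM a b = Some c -> fresh b w -> lcons a (ocons b w) = ocons c w.
Proof.
move=> abc bw; have sac : is_inl a = is_inl b by case: a b abc {bw} => ? [].
rewrite {1}/ocons; case b1: (letter1 b).
  by rewrite (letterM1 abc b1) lcons_fresh // (fresh_side _ sac).
rewrite /lcons; case a1: (letter1 a); last by rewrite abc.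
by rewrite (letter1M abc a1) /ocons b1.
Qed.

Lemma reduced_ocons a w : reduced w -> exists b w',
  [/\ w = ocons b w', is_inl b = is_inl a, fresh b w' & reduced w'].
Proof.
move=> rw; case: (boolP (fresh a w)) => [aw | ].
  exists (if a is inl _ then inl 1 else inr 1), w.
  by split=> //; case: a aw => ? //=; rewrite /ocons /= eqxx.
case: w rw => //= b w; rewrite reduced_cons => /and3P[b1 bw rw].
rewrite negbK => /eqP sab; exists b, w; split=> //.
by rewrite /ocons (negPf b1).
Qed.

Lemma reduced_ocons_fresh a w : fresh a w -> reduced w -> reduced (ocons a w).
Proof.
by move=> aw rw; rewrite /ocons; case: ifPn => // a1; rewrite reduced_cons a1 aw.
Qed.

Lemma reduced_lcons a w : reduced w -> reduced (lcons a w).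
Proof.
move=> /(reduced_ocons a)[b [w' [-> sab bw rw]]].
have [c abc] := letterM_eq (esym sab).
rewrite (lcons_ocons abc bw) reduced_ocons_fresh //.
by rewrite (fresh_side _ (letterM_side abc)).
Qed.

Lemma reduced_wmul u v : reduced v -> reduced (wmul u v).
Proof. by move=> rv; elim: u => //= a u; apply: reduced_lcons. Qed.

Lemma lconsM a b c w : letterM a b = Some c -> reduced w ->
  lcons a (lcons b w) = lcons c w.
Proof.
move=> abc /(reduced_ocons b)[d [w' [-> sbd dw rw]]].
have [e bde] := letterM_eq (esym sbd).
have [f cdf] : exists f, letterM c d = Some f.
  by apply: letterM_eq; rewrite (letterM_side abc).
rewrite (lcons_ocons bde dw) (lcons_ocons cdf dw) (@lcons_ocons _ _ f) //.
  by rewrite (letterMA abc bde).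
by rewrite (fresh_side _ (letterM_side bde)).
Qed.

Lemma wmul_lcons a u v : reduced v -> reduced u ->
  wmul (lcons a u) v = lcons a (wmul u v).
Proof.
move=> rv; rewrite /lcons; case a1: (letter1 a) => //; case: u => [|b u] ru.
  by rewrite /= /lcons a1.
case abc: (letterM a b) => [c|]; last first.
  by rewrite [wmul (a :: _) _]/= {1}/lcons a1.
rewrite -/(lcons a (wmul (b :: u) v)).
have -> : wmul (b :: u) v = lcons b (wmul u v) by [].
have := @lconsM a b c (wmul u v) abc (reduced_wmul u rv).
rewrite {1}/lcons a1 => ->.
by case: ifP => c1 //; rewrite /lcons c1.
Qed.

Lemma wmulA u v w : reduced v -> reduced w ->
  wmul u (wmul v w) = wmul (wmul u v) w.
Proof.
move=> rv rw; elim: u => //= a u ->.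
by rewrite wmul_lcons // reduced_wmul.
Qed.

Lemma wmulw1 w : reduced w -> wmul w [::] = w.
Proof.
elim: w => //= a w IHw; rewrite reduced_cons => /and3P[a1 aw rw].
by rewrite IHw // lcons_fresh // /ocons (negPf a1).
Qed.

Lemma letterVK : involutive letterV.
Proof. by case=> x /=; rewrite invgK. Qed.

Lemma is_inlV a : is_inl (letterV a) = is_inl a. Proof. by case: a. Qed.

Lemma letter1V a : letter1 (letterV a) = letter1 a.
Proof. by case: a => x /=; rewrite -(inj_eq invg_inj) invgK invg1. Qed.

Lemma winvK : involutive winv.
Proof. by move=> w; rewrite /winv map_rev revK mapK //; apply: letterVK. Qed.

Lemma reduced_winv w : reduced w -> reduced (winv w).
Proof.
rewrite /reduced /winv all_rev all_map rev_sorted sorted_map => /andP[w1 sw].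
apply/andP; split; first by apply: sub_all w1 => a /=; rewrite letter1V.
by apply: sub_sorted sw => a b /=; rewrite /alternating !is_inlV eq_sym.
Qed.

Lemma wmulVw w : reduced w -> wmul (winv w) w = [::].
Proof.
elim: w => //= a w IHw; rewrite reduced_cons => /and3P[a1 aw rw].
rewrite /winv map_cons rev_cons /wmul foldr_rcons -[RHS]IHw //.
congr foldr; rewrite /lcons letter1V (negPf a1).
by case: a {a1 aw} => x /=; rewrite mulVg eqxx.
Qed.

Record free_prod := FreeProd { fp_word : seq (G + H); _ : reduced fp_word }.

HB.instance Definition _ := [isSub for fp_word].
HB.instance Definition _ := [Choice of free_prod by <:].

Implicit Types x y z : free_prod.

Lemma fp_reduced x : reduced (fp_word x). Proof. exact: valP. Qed.

Lemma reduced_inl g : reduced (lcons (inl g) [::]).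
Proof. exact: reduced_lcons. Qed.

Lemma reduced_inr h : reduced (lcons (inr h) [::]).
Proof. exact: reduced_lcons. Qed.

Definition fp_inl (g : G) : free_prod := FreeProd (reduced_inl g).
Definition fp_inr (h : H) : free_prod := FreeProd (reduced_inr h).

Definition fp_one : free_prod := @FreeProd [::] isT.
Definition fp_mul x y : free_prod :=
  FreeProd (reduced_wmul (fp_word x) (fp_reduced y)).
Definition fp_inv x : free_prod := FreeProd (reduced_winv (fp_reduced x)).

Lemma fp_mulA : associative fp_mul.
Proof. by move=> x y z; apply/val_inj/wmulA; apply: fp_reduced. Qed.

Lemma fp_mul1 : left_id fp_one fp_mul.
Proof. by move=> x; apply: val_inj. Qed.

Lemma fp_mulr1 : right_id fp_one fp_mul.
Proof. by move=> x; apply/val_inj/wmulw1/fp_reduced. Qed.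

Lemma fp_mulV : left_inverse fp_one fp_inv fp_mul.
Proof. by move=> x; apply/val_inj/wmulVw/fp_reduced. Qed.

Lemma fp_mulrV : right_inverse fp_one fp_inv fp_mul.
Proof.
move=> x; apply/val_inj; rewrite /= -{1}[fp_word x]winvK.
exact/wmulVw/reduced_winv/fp_reduced.
Qed.

HB.instance Definition _ :=
  isGroup.Build free_prod fp_mulA fp_mul1 fp_mulr1 fp_mulV fp_mulrV.

End Words.

Section Universal.
Variables G H : groupType.

Lemma fp_inlM : {morph @fp_inl G H : x y / x * y}.
Proof.
move=> x y; apply: val_inj.
apply/esym/(etrans (wmul_lcons (inl x) (fp_reduced (fp_inl _ y)) _)) => //.
exact: lconsM.
Qed.

Lemma fp_inrM : {morph @fp_inr G H : x y / x * y}.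
Proof.
move=> x y; apply: val_inj.
apply/esym/(etrans (wmul_lcons (inr x) (fp_reduced (fp_inr _ y)) _)) => //.
exact: lconsM.
Qed.

HB.instance Definition _ := isMultiplicative.Build G (free_prod G H) _ fp_inlM.
HB.instance Definition _ := isMultiplicative.Build H (free_prod G H) _ fp_inrM.

Section Eval.
Variables (K : groupType) (f : {multiplicative G -> K}).
Variable (g : {multiplicative H -> K}).

Definition leval (a : G + H) : K :=
  match a with inl x => f x | inr y => g y end.

Definition weval (w : seq (G + H)) : K := \prod_(a <- w) leval a.

Lemma leval1 a : letter1 a -> leval a = 1.
Proof.
have m1 (L : groupType) (k : {multiplicative L -> K}) : k 1 = 1.
  by apply: (mulgI (k 1)); rewrite -gmulfM !mulg1.
by case: a => x /= /eqP->; apply: m1.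
Qed.

Lemma weval_lcons a w : weval (lcons a w) = leval a * weval w.
Proof.
rewrite /lcons /weval; case: ifP => [/leval1-> | _]; first by rewrite mul1g.
case: w => [|b w]; first by rewrite big_cons big_nil.
case abc: (letterM a b) => [c|]; last by rewrite big_cons.
have lc : leval c = leval a * leval b.
  by case: a b abc => x [] y //= [<-]; rewrite /= gmulfM.
rewrite [in RHS]big_cons mulgA -lc.
by case: ifP => [/leval1->|_]; rewrite ?mul1g // big_cons.
Qed.

Definition fp_eval (x : free_prod G H) : K := weval (fp_word x).

Lemma fp_evalM : {morph fp_eval : x y / x * y}.
Proof.
move=> x y; rewrite /fp_eval /= /wmul.
elim: (fp_word x) => [|a w IHw] /=; first by rewrite /weval big_nil mul1g.
by rewrite weval_lcons IHw /weval big_cons mulgA.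
Qed.

HB.instance Definition _ := isMultiplicative.Build (free_prod G H) K _ fp_evalM.

End Eval.

Lemma free_prod_universal (K : groupType)
    (f : {multiplicative G -> K}) (g : {multiplicative H -> K}) :
  exists k : {multiplicative free_prod G H -> K},
    [/\ forall x, k (fp_inl H x) = f x, forall y, k (fp_inr G y) = g y
      & forall k' : {multiplicative free_prod G H -> K},
          (forall x, k' (fp_inl H x) = f x) ->
          (forall y, k' (fp_inr G y) = g y) -> k' =1 k].
Proof.
have evl a : weval f g (lcons a [::]) = leval f g a.
  by rewrite weval_lcons /weval big_nil mulg1.
exists (fp_eval f g); split=> [x|y|k' k'f k'g]; do ?exact: evl.
case=> w rw; rewrite /= /fp_eval /=.
elim: w rw => [|a w IHw] rw.
  rewrite /weval big_nil; apply: (mulgI (k' (FreeProd rw))).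
  by rewrite -gmulfM mulg1; congr (k' _); apply: val_inj.
have := rw; rewrite reduced_cons => /and3P[a1 aw rw'].
rewrite /weval big_cons -/(weval f g w) -(IHw rw').
pose ia := match a with inl x => fp_inl H x | inr y => fp_inr G y end.
have -> : FreeProd rw = ia * FreeProd rw'.
  have lw : lcons a w = a :: w by rewrite lcons_fresh // /ocons (negPf a1).
  apply: val_inj; rewrite [LHS](esym lw).
  have -> : val (ia * FreeProd rw') = wmul (lcons a [::]) w.
    by rewrite /ia; case: (a).
  by rewrite wmul_lcons.
by rewrite gmulfM; congr (_ * _); rewrite /ia; case: (a).
Qed.

End Universal.

Record is_biorder (K : groupType) (lt : K -> K -> Prop) : Prop := IsBiorder {
  biorder_irr : forall x, ~ lt x x;
  biorder_trans : forall x y z, lt x y -> lt y z -> lt x z;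
  biorder_total : forall x y, [\/ lt x y, x = y | lt y x];
  biorder_mull : forall x y z, lt x y -> lt (z * x) (z * y);
  biorder_mulr : forall x y z, lt x y -> lt (x * z) (y * z)
}.

Definition bi_orderable (K : groupType) : Prop :=
  exists lt : K -> K -> Prop, is_biorder lt.

Definition positive (K : groupType) (lt : K -> K -> Prop) (k : K) : Prop :=
  lt 1 k.

Definition same_order (K : Type) (lt1 lt2 : K -> K -> Prop) : Prop :=
  forall x y, lt1 x y <-> lt2 x y.

Definition isolated_biorder (K : groupType) (lt : K -> K -> Prop) : Prop :=
  is_biorder lt /\
  exists2 S : seq K, {in S, forall k, positive lt k} &
    forall lt' : K -> K -> Prop, is_biorder lt' ->
      {in S, forall k, positive lt' k} -> same_order lt' lt.

(* A free product is understood to have nontrivial factors: if G is trivial,  *)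
(* then G * H is H, and for instance the two bi-orders of H = Z are isolated. *)
Definition nontrivial (K : groupType) : Prop := exists k : K, k <> 1.

(* Main.v *)
Require Import Defs.
From mathcomp Require Import all_boot boolp.
From Stdlib Require Import ZArith.
From mathcomp Require Import zify.
Import Defs.

Set Implicit Arguments.
Unset Strict Implicit.
Unset Printing Implicit Defensive.

Local Open Scope group_scope.

(** A change of the order that only concerns elements infinitely small compared
    with S keeps S positive, and a free product has room for two such changes
    that contradict each other.

    Let D be the convex subgroup of the elements that are infinitely small
    compared with all s ^ p, where s is in S and p is a prefix of s.  By the
    argument of Hoelder, if nothing were infinitely small compared with some
    positive e, then the conjugates of e would commute with each other, which
    fails in a free product (noncommuting_conj).  So D is nontrivial, and it
    contains words that begin in either factor (infinitesimal_starts).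

    An element w is seen at the location u if w ^ u lies in D.  Locations matter
    up to right multiplication by D, and are ordered by below: first by the size
    of the conjugates of D, then by the given order.  Call some elements of D
    active, in such a way that w ^ u is active only if u lies in p * D for a
    prefix p of w.  Then w has a highest location where it is active, its lead,
    unless it is nowhere active, and it can be given a new sign according to what
    happens in D at the lead.  An element that is nowhere active keeps its sign;
    this is the case for s in S, which would otherwise have an infinitely small
    conjugate s ^ p.  At the highest of the leads of w, w' and w * w' all three
    are seen together (product_cases), so that the axioms of a bi-order only have
    to be checked inside D.

    The action on D comes from the paths in the tree of the free product.
    Counting with signs the letters of the second factor that leave or enter the
    vertices in D is a homomorphism from D to the integers, the crossing number.

    If it is not zero on D, let the elements of D with nonzero crossing number be
    active and take the sign of this number, or of its opposite.  The two orders
    disagree, hence one of them differs from the given one (sign_orders_differ).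

    If it is zero on D, then D cuts the tree into two sides.  Deleting from a
    word the letters on one side gives two homomorphisms on D.  An order is
    obtained by looking at the image of the lead under the first of them, and, if
    this is trivial, under the second; both images are compared recursively,
    which is well founded because elements of D that live on one side only are
    declared inactive, and the other ones lose letters (retr1_shrinks).
    Exchanging the two homomorphisms gives another order.  A shortest active
    element is conjugate to a product x * y of a loop x on one side and a loop y
    on the other; one order gives it the sign of x and the other one the sign of
    y.  The same holds for x^-1 * y, so the two orders cannot both be the given
    one (split_orders_differ). *)

(** * Bi-ordered groups *)

Section OrderedGroup.
Variables (K : groupType) (lt : K -> K -> Prop).
Hypothesis ltO : is_biorder lt.
Implicit Types (x y z k u v w : K).

Lemma lt_asym x y : lt x y -> ~ lt y x.
Proof. by move=> xy yx; exact: (biorder_irr ltO (biorder_trans ltO xy yx)). Qed.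

Lemma lt_mul x y z w : lt x y -> lt z w -> lt (x * z) (y * w).
Proof.
move=> xy zw; apply: (biorder_trans ltO (biorder_mulr ltO z xy)).
exact: biorder_mull.
Qed.

Lemma lt_conj k x y : lt x y -> lt (x ^ k) (y ^ k).
Proof. by move=> xy; apply: (biorder_mull ltO); apply: biorder_mulr. Qed.

Lemma pos_conj k x : lt 1 x -> lt 1 (x ^ k).
Proof. by move/(lt_conj k); rewrite conj1g. Qed.

Lemma ltVg x y : lt x y -> lt y^-1 x^-1.
Proof.
move=> /(biorder_mull ltO x^-1) /(biorder_mulr ltO y^-1).
by rewrite mulVg mul1g mulgK.
Qed.

Lemma posV x : lt x 1 -> lt 1 x^-1.
Proof. by move/ltVg; rewrite invg1. Qed.

Lemma lt_div x y : lt x y -> lt 1 (x^-1 * y).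
Proof. by move/(biorder_mull ltO x^-1); rewrite mulVg. Qed.

Lemma div_lt x y : lt 1 (x^-1 * y) -> lt x y.
Proof. by move/(biorder_mull ltO x); rewrite mulg1 mulVKg. Qed.

Lemma pos_total x : x <> 1 -> lt 1 x \/ lt 1 x^-1.
Proof. by move=> x1; case: (biorder_total ltO 1 x) => [|/esym|/posV]; auto. Qed.

Lemma pos_mul x y : lt 1 x -> lt 1 y -> lt 1 (x * y).
Proof. by move=> x1 y1; rewrite -(mulg1 1); apply: lt_mul. Qed.

Lemma lt_exp x y n : lt x y -> lt (x ^+ n.+1) (y ^+ n.+1).
Proof.
move=> xy; elim: n => [|n IHn]; first by rewrite !expg1.
by rewrite !(expgS _ n.+1); apply: lt_mul.
Qed.

(** The bi-invariant orders are the orders defined by the positive cones. *)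
Lemma biorder_of_cone (P : K -> Prop) :
    ~ P 1 -> (forall x y, P x -> P y -> P (x * y)) ->
    (forall x, x <> 1 -> P x \/ P x^-1) -> (forall k x, P x -> P (x ^ k)) ->
  is_biorder (fun x y => P (x^-1 * y)).
Proof.
move=> P1 PM PT PJ; split.
- by move=> x; rewrite mulVg.
- by move=> x y z xy yz; have := PM _ _ xy yz; rewrite mulgA mulgK.
- move=> x y; have [->|xy] := pselect (x = y); first by constructor 2.
  have /PT[] : x^-1 * y <> 1 by move/mulg1_eq; rewrite invgK.
    by constructor 1.
  by rewrite invgM invgK; constructor 3.
- by move=> x y z; rewrite invgM mulgA mulgVK.
- by move=> x y z /(PJ z); rewrite conjgE invgM !mulgA.
Qed.

Record convex_subgroup (D : K -> Prop) : Prop := ConvexSubgroup {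
  convex1 : D 1;
  convexM : forall x y, D x -> D y -> D (x * y);
  convexV : forall x, D x -> D x^-1;
  convex_lt : forall x y, lt 1 x -> lt x y -> D y -> D x
}.

Lemma convex_conj D u : convex_subgroup D -> convex_subgroup (fun x => D (x ^ u)).
Proof.
move=> cD; split=> [|x y|x|x y x1 xy].
- by rewrite conj1g; apply: convex1.
- by rewrite conjMg; apply: (convexM cD).
- by rewrite conjVg; apply: (convexV cD).
by apply: (convex_lt cD); [apply: pos_conj | apply: lt_conj].
Qed.

Lemma convexVE D x : convex_subgroup D -> D x^-1 -> D x.
Proof. by move=> cD /(convexV cD); rewrite invgK. Qed.

Lemma lt_convex D x y : convex_subgroup D -> D x -> ~ D y -> lt 1 y -> lt x y.
Proof.
move=> cD Dx Dy y1; case: (biorder_total ltO x y) => // [xy|yx].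
  by case: Dy; rewrite -xy.
by case: Dy; apply: convex_lt y1 yx Dx.
Qed.

(** Two convex subgroups are comparable: an element of B outside A exceeds, up to
    inversion, all of A. *)
Lemma convex_chain A B w x : convex_subgroup A -> convex_subgroup B ->
  B w -> ~ A w -> A x -> B x.
Proof.
move=> cA cB.
wlog x1 : x / lt 1 x.
  move=> IH Bw Aw Ax; have [->|/pos_total[]] := pselect (x = 1).
  - exact: convex1.
  - by move/IH; apply.
  by move/IH => IHx; apply/(convexVE cB)/IHx=> //; apply: convexV.
wlog w1 : w / lt 1 w.
  move=> IH Bw Aw Ax; have /pos_total[/IH|/IH] : w <> 1.
  - by move=> w1; case: Aw; rewrite w1; apply: convex1.
  - by apply.
  - apply=> //; first exact: convexV.
  by move/(convexVE cA).
by move=> Bw Aw Ax; apply: convex_lt Bw => //; apply: lt_convex cA _ _ _.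
Qed.

End OrderedGroup.

(** * Locations *)

Section Locations.
Variables (K : groupType) (lt : K -> K -> Prop) (D : K -> Prop).
Hypotheses (ltO : is_biorder lt) (cD : convex_subgroup lt D).
Implicit Types (x y z k d u v w : K).

(** The element u stands for the conjugate of D consisting of the w with
    D (w ^ u).  A larger conjugate is higher; the cosets of D that give the same
    conjugate are compared by means of their representatives. *)
Definition below u v : Prop :=
  (exists2 w, D (w ^ v) & ~ D (w ^ u)) \/
  [/\ forall w, D (w ^ u) <-> D (w ^ v), lt u v & ~ D (u^-1 * v)].

Let cJ u : convex_subgroup lt (fun w => D (w ^ u)).
Proof. exact: convex_conj. Qed.

Lemma conj_convex d x : D d -> D (x ^ d) <-> D x.
Proof.
move=> Dd; have sub e y : D e -> D y -> D (y ^ e).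
  by move=> De Dy; apply: (convexM cD); [apply: (convexV cD) | apply: (convexM cD)].
split=> [/(sub d^-1 _ (convexV cD Dd))|]; last exact: sub.
by rewrite conjgK.
Qed.

Lemma below_sub u v w : below u v -> D (w ^ u) -> D (w ^ v).
Proof.
case=> [[x xv xu]|[uv _ _]]; last by move/uv.
exact: (convex_chain ltO (cJ u) (cJ v) xv).
Qed.

Lemma below_right u v d : D d -> below u v -> below u (v * d).
Proof.
move=> Dd [[w wv wu]|[uv u_lt_v Duv]].
  by left; exists w => //; rewrite conjgM; apply/conj_convex.
right; split=> [w||].
- by apply: (iff_trans (uv w)); rewrite conjgM; exact: iff_sym (conj_convex _ Dd).
- apply: (div_lt ltO); rewrite mulgA.
  have := lt_convex ltO cD (convexV cD Dd) Duv (lt_div ltO u_lt_v).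
  by move/(biorder_mulr ltO d); rewrite mulVg.
- rewrite mulgA => /(convexM cD)/(_ (convexV cD Dd)); rewrite mulgK.
  exact: Duv.
Qed.

Lemma below_total u v : [\/ below u v, below v u | D (u^-1 * v)].
Proof.
have [uv|] := pselect (forall w, D (w ^ u) <-> D (w ^ v)); last first.
  case/existsNP=> w; have [wu|wu] := pselect (D (w ^ u)).
    have [wv|wv _] := pselect (D (w ^ v)); first by case; split.
    by constructor 2; left; exists w.
  have [wv _|wv] := pselect (D (w ^ v)); last by case; split.
  by constructor 1; left; exists w.
have [Duv|Duv] := pselect (D (u^-1 * v)); first by constructor 3.
case: (biorder_total ltO u v) => [ltuv|eq_uv|ltvu].
- by constructor 1; right.
- by case: Duv; rewrite eq_uv mulVg; apply: (convex1 cD).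
constructor 2; right; split=> // [w|]; first exact: iff_sym.
by rewrite -[v^-1 * u]invgK => /(convexVE cD); rewrite invgM invgK.
Qed.

Lemma below_irr u : ~ below u u.
Proof. by case=> [[w]|[_ /(biorder_irr ltO)]]. Qed.

Lemma below_trans u v w : below u v -> below v w -> below u w.
Proof.
move=> uv vw; have uw x : D (x ^ u) -> D (x ^ w).
  by move/(below_sub uv)/(below_sub vw).
have [eq_uw|] := pselect (forall x, D (x ^ u) <-> D (x ^ w)); last first.
  case/existsNP=> x ne; left; exists x.
    apply: contrapT => xw; apply: ne; split=> [/uw//|//].
  by move=> xu; apply: ne; split=> // _; apply: uw.
have eq_uv x : D (x ^ u) <-> D (x ^ v).
  by split=> [/(below_sub uv)//|/(below_sub vw)/eq_uw].
case: uv => [[x xv]|[_ ltuv Duv]]; first by case; apply/eq_uv.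
case: vw => [[x xw]|[_ ltvw Dvw]]; first by case; apply/eq_uv/eq_uw.
right; split=> //; first exact: biorder_trans ltuv ltvw.
move=> Duw; case: Duv; apply: (convex_lt cD _ _ Duw).
  exact: lt_div.
exact: biorder_mull.
Qed.

Lemma below_left k u v : below u v -> below (k * u) (k * v).
Proof.
have conjM w z : (w ^ k^-1) ^ (k * z) = w ^ z by rewrite conjgM conjgKV.
case=> [[w wv wu]|[uv ltuv Duv]].
  by left; exists (w ^ k^-1); rewrite conjM.
right; split; first by move=> w; rewrite !conjgM.
  exact: biorder_mull.
by rewrite invgM mulgA mulgVK.
Qed.

(** Finitely many locations up to D have one that is below no other. *)
Lemma maximal_location (Q : K -> Prop) (s : seq K) :
    (forall u d, D d -> Q u -> Q (u * d)) ->
    (forall u, Q u -> exists2 p, p \in s & D (p^-1 * u)) ->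
  (exists u, Q u) -> exists2 u, Q u & forall v, Q v -> ~ below u v.
Proof.
move=> QD Qs [u0 Qu0].
have [m Qm max_m] : exists2 m, Q m & {in s, forall p, Q p -> ~ below m p}.
  elim: s {Qs} => [|p s [m Qm max_m]]; first by exists u0.
  have [[Qp mp]|no] := pselect (Q p /\ below m p).
    exists p => // q; rewrite inE => /orP[/eqP->|q_s] Qq; first exact: below_irr.
    by move/(below_trans mp); apply: max_m.
  exists m => // q; rewrite inE => /orP[/eqP->|]; last exact: max_m.
  by move=> Qp mp; apply: no.
exists m => // v Qv mv; have [p p_s Dpv] := Qs v Qv.
have Dvp : D (v^-1 * p) by apply: (convexVE cD); rewrite invgM invgK.
have ep : v * (v^-1 * p) = p by rewrite mulVKg.
apply: (max_m p p_s); first by rewrite -ep; apply: QD.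
by rewrite -ep; apply: below_right.
Qed.

Variable act : K -> Prop.
Hypotheses (act_sub : forall d, act d -> D d).
Hypothesis actJ : forall k d, D k -> act d -> act (d ^ k).
(* The locations where w is active form finitely many cosets of D. *)
Hypothesis visited : forall w, exists s : seq K,
  forall u, act (w ^ u) -> exists2 p, p \in s & D (p^-1 * u).

Definition leads u w : Prop :=
  act (w ^ u) /\ forall v, act (w ^ v) -> ~ below u v.

Lemma leads_exists w u : act (w ^ u) -> exists v, leads v w.
Proof.
move=> au; have [s vis] := visited w.
have [||v av max_v] := @maximal_location (fun v => act (w ^ v)) s _ vis.
- by move=> v d Dd av; rewrite conjgM; apply: actJ.
- by exists u.
by exists v.
Qed.

Lemma leads_same u v w : leads u w -> leads v w -> D (u^-1 * v).
Proof.
by move=> [au mu] [av mv]; case: (below_total u v) => [/(mu v av)|/(mv u au)|].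
Qed.

Lemma leads_conj k u w : leads u w -> leads (k * u) (w ^ k^-1).
Proof.
have E z : (w ^ k^-1) ^ z = w ^ (k^-1 * z) by rewrite conjgM.
case=> au mu; split=> [|v]; rewrite E ?mulKg // => /mu + /(below_left k^-1).
by rewrite mulKg.
Qed.

(** Take u highest among the locations where one of w, w' and w * w' is active.
    If D (w ^ u) fails, then w is active nowhere, since a location where it is
    active would be higher than u; in this case w is not small compared with the
    conjugate of D at u, and it decides the sign of the product whenever w' is
    small. *)
Lemma product_cases w w' :
    ((forall u, ~ act (w ^ u)) -> lt 1 w) ->
    ((forall u, ~ act (w' ^ u)) -> lt 1 w') ->
  ((forall u, ~ act ((w * w') ^ u)) /\ lt 1 (w * w')) \/
  exists u, [/\ D (w ^ u), D (w' ^ u),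
    [\/ act (w ^ u), act (w' ^ u) | act ((w * w') ^ u)] &
    forall z, [\/ z = w, z = w' | z = w * w'] -> act (z ^ u) -> leads u z].
Proof.
move=> posw posw'.
pose Q u := [\/ act (w ^ u), act (w' ^ u) | act ((w * w') ^ u)].
have [[u0 Qu0]|noQ] := pselect (exists u, Q u); last first.
  left; split; first by move=> u au; apply: noQ; exists u; constructor 3.
  apply: (pos_mul ltO).
    by apply: posw => u au; apply: noQ; exists u; constructor 1.
  by apply: posw' => u au; apply: noQ; exists u; constructor 2.
have [s1 vis1] := visited w; have [s2 vis2] := visited w'.
have [s3 vis3] := visited (w * w').
have [||u Qu max_u] := @maximal_location Q (s1 ++ s2 ++ s3) _ _ (ex_intro _ _ Qu0).
- by move=> v d Dd [] av; [constructor 1|constructor 2|constructor 3];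
    rewrite conjgM; apply: actJ.
- move=> v [/vis1|/vis2|/vis3] [p ps Dp]; exists p => //;
    by rewrite !mem_cat ps ?orbT.
have idle z : [\/ z = w, z = w' | z = w * w'] -> ~ D (z ^ u) ->
    forall v, ~ act (z ^ v).
  move=> ez Dzu v av; apply: (max_u v); last by left; exists z => //; apply: act_sub.
  by case: ez av => -> av; [constructor 1|constructor 2|constructor 3].
have DM x y : D (x ^ u) -> D (y ^ u) -> D ((x * y) ^ u).
  by rewrite conjMg; apply: (convexM cD).
have DV x : D (x ^ u) -> D (x^-1 ^ u) by rewrite conjVg; apply: (convexV cD).
have [Dw|Dw] := pselect (D (w ^ u)); have [Dw'|Dw'] := pselect (D (w' ^ u)).
- right; exists u; split=> // z ez az; split=> // v av; apply: max_u.
  by case: ez av => -> av; [constructor 1|constructor 2|constructor 3].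
- have Dww : ~ D ((w * w') ^ u).
    by move=> Dww; apply: Dw'; rewrite -[w'](mulKg w); apply: DM => //; apply: DV.
  left; split; first by apply: idle => //; constructor 3.
  have w'1 : lt 1 w' by apply/posw'/idle => //; constructor 2.
  have := lt_convex ltO (cJ u) (DV _ Dw) Dw' w'1.
  by move/(biorder_mull ltO w); rewrite mulgV.
- have Dww : ~ D ((w * w') ^ u).
    by move=> Dww; apply: Dw; rewrite -[w](mulgK w'); apply: DM => //; apply: DV.
  left; split; first by apply: idle => //; constructor 3.
  have w1 : lt 1 w by apply/posw/idle => //; constructor 1.
  have := lt_convex ltO (cJ u) (DV _ Dw') Dw w1.
  by move/(biorder_mulr ltO w'); rewrite mulVg.
- have w1 : lt 1 w by apply/posw/idle => //; constructor 1.
  have w'1 : lt 1 w' by apply/posw'/idle => //; constructor 2.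
  left; split; last exact: pos_mul.
  apply: idle; first by constructor 3.
  move=> Dww; apply: Dw; apply: (convex_lt (cJ u) w1 _ Dww).
  by have := biorder_mull ltO w w'1; rewrite mulg1.
Qed.

End Locations.

(** * Infinitesimal elements *)

Section Infinitesimals.
Variables (K : groupType) (lt : K -> K -> Prop).
Hypothesis ltO : is_biorder lt.
Implicit Types (a b c d e x y z k : K) (E : seq K).

Definition infinitesimal E x : Prop :=
  forall e, e \in E -> forall n, lt (x ^+ n.+1) e /\ lt (x^-1 ^+ n.+1) e.

Lemma infinitesimal_convex E : (forall e, e \in E -> lt 1 e) ->
  convex_subgroup lt (infinitesimal E).
Proof.
move=> posE.
have small_mul e x y : (forall n, lt (x ^+ n.+1) e) ->
    (forall n, lt (y ^+ n.+1) e) -> forall n, lt ((x * y) ^+ n.+1) e.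
  have dbl z n : (z * z) ^+ n.+1 = z ^+ (n.*2.+1).+1.
    by rewrite -expg2 -expgnA mul2n doubleS.
  move=> xe ye n; case: (biorder_total ltO x y) => [xy|<-|yx].
  - apply: (biorder_trans ltO _ (ye n.*2.+1)); rewrite -dbl.
    exact/(lt_exp ltO)/(biorder_mulr ltO).
  - by rewrite dbl.
  - apply: (biorder_trans ltO _ (xe n.*2.+1)); rewrite -dbl.
    exact/(lt_exp ltO)/(biorder_mull ltO).
split.
- by move=> e /posE e1 n; rewrite invg1 expg1n.
- move=> x y Dx Dy e eE n; rewrite invgM; split; apply: small_mul => m.
  + by case: (Dx e eE m).
  + by case: (Dy e eE m).
  + by case: (Dy e eE m).
  + by case: (Dx e eE m).
- by move=> x Dx e eE n; rewrite invgK; case: (Dx e eE n).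
- move=> x y x1 xy Dy e eE n; have [ye _] := Dy e eE n.
  split; apply: (biorder_trans ltO _ ye); apply: (lt_exp ltO) => //.
  apply: (biorder_trans ltO _ (biorder_trans ltO x1 xy)).
  by have := ltVg ltO x1; rewrite invg1.
Qed.

Lemma infinitesimal_notin E e : e \in E -> ~ infinitesimal E e.
Proof. by move=> eE /(_ e eE 0)[]; rewrite expg1 => /(biorder_irr ltO). Qed.

Lemma infinitesimal_conj E k x :
  infinitesimal [seq e ^ k^-1 | e <- E] x -> infinitesimal E (x ^ k).
Proof.
move=> small e eE n; have [] := small _ (map_f _ eE) n.
move=> /(lt_conj ltO k) + /(lt_conj ltO k).
by rewrite !conjgKV -conjVg !conjXg.
Qed.

Lemma lt_not_lt x y z : lt x y -> ~ lt z y -> lt x z.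
Proof.
move=> xy zy; case: (biorder_total ltO y z) => [yz|<- //|//].
exact: biorder_trans xy yz.
Qed.

Lemma not_lt_lt x y z : ~ lt y x -> lt y z -> lt x z.
Proof.
move=> yx yz; case: (biorder_total ltO x y) => [xy|-> //|//].
exact: biorder_trans xy yz.
Qed.

Lemma not_lt_mul x y z w : ~ lt y x -> ~ lt w z -> ~ lt (y * w) (x * z).
Proof.
move=> xy zw; case: (biorder_total ltO x y) => [lxy|->|//].
  case: (biorder_total ltO z w) => [lzw|->|//]; apply: (lt_asym ltO).
    exact: lt_mul.
  exact: biorder_mulr.
move/(biorder_mull ltO y^-1); rewrite !mulKg; exact: zw.
Qed.

Lemma floor_exp d a n : lt 1 a -> lt a (d ^+ n.+1) ->
  exists2 m, ~ lt a (d ^+ m) & lt a (d ^+ m.+1).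
Proof.
move=> a1; elim: n => [|n IHn] an.
  by exists 0 => //; apply: lt_asym.
have [/IHn //|no] := pselect (lt a (d ^+ n.+1)).
by exists n.+1.
Qed.

Hypothesis conj_free : forall x, x <> 1 -> exists k l, ~ commute (x ^ k) (x ^ l).

(** If y lies between 1 and c, then y or y^-1 * c has a square that is at most c.
    Otherwise c is the least positive element, hence fixed by conjugation. *)
Lemma dense_square c : lt 1 c -> exists2 d, lt 1 d & ~ lt c (d * d).
Proof.
move=> c1; have [[y y1 yc]|no] := pselect (exists2 y, lt 1 y & lt y c).
  have [cyy|] := pselect (lt c (y * y)); last by exists y.
  exists (y^-1 * c); first exact: lt_div.
  apply: (lt_asym ltO); rewrite -{3}(mulVKg y c); apply: (biorder_mulr ltO).
  by have := biorder_mull ltO y^-1 cyy; rewrite mulKg.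
have no_conj k : ~ lt (c ^ k) c by move=> ck; apply: no; exists (c ^ k) => //; apply: pos_conj.
have fixc k : c ^ k = c.
  case: (biorder_total ltO (c ^ k) c) => // [/no_conj//|].
  by move/(lt_conj ltO k^-1); rewrite conjgK => /no_conj.
have [|k [l]] := conj_free (x := c); last by rewrite !fixc; case.
by move=> e; move: c1; rewrite e => /(biorder_irr ltO).
Qed.

(** If b * a < a * b, let c be the quotient and d ^+ 2 at most c.  With a and b
    between consecutive powers of d, a * b is less than the product of the upper
    bounds, which is at most b * a * d ^+ 2, hence at most a * b. *)
Lemma archimedean_comm a b : lt 1 a -> lt 1 b ->
    (forall y, lt 1 y -> exists n, lt a (y ^+ n.+1)) ->
    (forall y, lt 1 y -> exists n, lt b (y ^+ n.+1)) ->
  ~ lt (b * a) (a * b).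
Proof.
move=> a1 b1 archa archb ba; have [d d1 dc] := dense_square (lt_div ltO ba).
have [n /(floor_exp a1)[m ma am]] := archa d d1.
have [n' /(floor_exp b1)[m' mb bm]] := archb d d1.
have := lt_mul ltO am bm.
have -> : d ^+ m.+1 * d ^+ m'.+1 = d ^+ m' * d ^+ m * (d * d).
  by rewrite -!expgnDr -expg2 -expgnDr; congr (_ ^+ _); lia.
have := not_lt_mul (not_lt_mul mb ma) dc; rewrite mulVKg.
by move=> no yes; apply: no.
Qed.

(** Otherwise all positive elements have powers beyond e, hence beyond each
    conjugate of e, and the conjugates of e commute. *)
Lemma small_exists e : lt 1 e ->
  exists2 y, lt 1 y & forall n, lt (y ^+ n.+1) e.
Proof.
move=> e1; apply: contrapT => no.
have arch y : lt 1 y -> exists n, lt e (y ^+ n.+1).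
  move=> y1; have [n yn] : exists n, ~ lt (y ^+ n.+1) e.
    by apply/existsNP => ye; apply: no; exists y.
  exists n.+1; apply: (not_lt_lt yn).
  by have := biorder_mull ltO (y ^+ n.+1) y1; rewrite mulg1 -expgSr.
have archJ k y : lt 1 y -> exists n, lt (e ^ k) (y ^+ n.+1).
  move=> /(pos_conj ltO k^-1)/arch[n /(lt_conj ltO k)].
  by rewrite conjXg conjgKV; exists n.
have [|k [l]] := conj_free (x := e).
  by move=> ee; move: e1; rewrite ee => /(biorder_irr ltO).
case; rewrite /commute; set a := e ^ k; set b := e ^ l.
have a1 : lt 1 a := pos_conj ltO k e1.
have b1 : lt 1 b := pos_conj ltO l e1.
by case: (biorder_total ltO (a * b) (b * a)) => // /archimedean_comm;
   case=> //; apply: archJ.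
Qed.

Lemma infinitesimal_exists E : (forall e, e \in E -> lt 1 e) ->
  (exists x : K, x <> 1) -> exists2 x, x <> 1 & infinitesimal E x.
Proof.
move=> posE [x0 x01].
have [m m1 minE] : exists2 m, lt 1 m & forall e, e \in E -> ~ lt e m.
  elim: E posE => [|e E IH] posE.
    by case: (pos_total ltO x01) => p; [exists x0 | exists x0^-1].
  have [|m m1 minE] := IH; first by move=> f fE; apply: posE; rewrite inE fE orbT.
  have [em|em] := pselect (lt e m); last first.
    by exists m => // f; rewrite inE => /orP[/eqP->//|/minE].
  exists e; first by apply: posE; rewrite mem_head.
  move=> f; rewrite inE => /orP[/eqP->|/minE]; first exact: biorder_irr.
  by move=> mf fe; apply: mf; apply: biorder_trans fe em.
have [y y1 ym] := small_exists m1; exists y.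
  by move=> e; move: y1; rewrite e => /(biorder_irr ltO).
move=> e eE n; have ye : lt (y ^+ n.+1) e := lt_not_lt (ym n) (minE e eE).
split=> //; apply: (biorder_trans ltO _ ye); apply: (lt_exp ltO).
by apply: (biorder_trans ltO _ y1); have := ltVg ltO y1; rewrite invg1.
Qed.

End Infinitesimals.

(** * Reordering by an integer valued homomorphism *)

Section SignOrder.
Variables (K : groupType) (lt : K -> K -> Prop) (D : K -> Prop) (c : K -> Z).
Hypotheses (ltO : is_biorder lt) (cD : convex_subgroup lt D).
Hypothesis cM : forall x y, D x -> D y -> c (x * y) = (c x + c y)%Z.
Implicit Types (x y z k d u v w : K).

Definition nonzero d : Prop := D d /\ c d <> 0%Z.

Hypothesis visited : forall w, exists s : seq K,
  forall u, nonzero (w ^ u) -> exists2 p, p \in s & D (p^-1 * u).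

Local Notation lead := (leads lt D nonzero).

Definition sign_pos w : Prop :=
  (forall u, ~ nonzero (w ^ u)) /\ lt 1 w \/
  (exists2 u, lead u w & (0 < c (w ^ u))%Z).

Lemma sign_hom1 : c 1 = 0%Z.
Proof. by have := cM (convex1 cD) (convex1 cD); rewrite mulg1; lia. Qed.

Lemma sign_homV d : D d -> c d^-1 = (- c d)%Z.
Proof. by move=> Dd; have := cM Dd (convexV cD Dd); rewrite mulgV sign_hom1; lia. Qed.

Lemma sign_homJ k d : D k -> D d -> c (d ^ k) = c d.
Proof.
move=> Dk Dd; rewrite conjgE !cM ?sign_homV //; first by lia.
- exact: (convexV cD).
- exact: (convexM cD).
Qed.

Lemma nonzeroJ k d : D k -> nonzero d -> nonzero (d ^ k).
Proof.
move=> Dk [Dd cd]; split; last by rewrite sign_homJ.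
exact/(conj_convex cD).
Qed.

Lemma nonzero_sub d : nonzero d -> D d. Proof. by case. Qed.

Lemma sign_posE u w : lead u w -> sign_pos w <-> (0 < c (w ^ u))%Z.
Proof.
move=> lu; split=> [[[no _]|[v lv pv]]|pu]; last by right; exists u.
  by case: (no u); case: lu.
have Duv := leads_same ltO cD lv lu.
have Dv : D (w ^ v) by case: lv => /nonzero_sub.
by rewrite -(mulVKg v u) conjgM sign_homJ.
Qed.

Lemma sign_pos_inert w : (forall u, ~ nonzero (w ^ u)) ->
  sign_pos w <-> lt 1 w.
Proof.
by move=> no; split=> [[[]|[u [/no]]]//|w1]; left.
Qed.

Lemma sign_pos_total w : w <> 1 -> sign_pos w \/ sign_pos w^-1.
Proof.
move=> w1; have [[u au]|no] := pselect (exists u, nonzero (w ^ u)).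
  have [v lv] := leads_exists ltO cD nonzeroJ visited au.
  have [[Dv cv] mv] := lv.
  have E z : nonzero (w^-1 ^ z) -> nonzero (w ^ z).
    rewrite conjVg => -[/(convexVE cD) Dz cz]; split=> // c0.
    by apply: cz; rewrite sign_homV // c0.
  have lvV : lead v w^-1.
    split; last by move=> z /E; apply: mv.
    by rewrite conjVg; split; [apply: (convexV cD) | rewrite sign_homV //; lia].
  have [pv|pv] : (0 < c (w ^ v))%Z \/ (0 < c (w^-1 ^ v))%Z.
  - by rewrite conjVg sign_homV //; lia.
  - by left; apply/(sign_posE lv).
  by right; apply/(sign_posE lvV).
have no' z u : z = w \/ z = w^-1 -> ~ nonzero (z ^ u).
  case=> -> [Du cu]; apply: no; exists u => //.
  move: Du cu; rewrite conjVg => /(convexVE cD) Du; rewrite sign_homV // => cu.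
  by split=> // c0; apply: cu; rewrite c0.
case: (pos_total ltO w1) => [pw|pw]; [left|right].
  by apply/sign_pos_inert => // u; apply: no'; left.
by apply/sign_pos_inert => // u; apply: no'; right.
Qed.

Lemma sign_posJ k w : sign_pos w -> sign_pos (w ^ k).
Proof.
case=> [[no w1]|[u lu pu]].
  left; split; last exact: pos_conj.
  by move=> u; rewrite -conjgM; apply: no.
right; exists (k^-1 * u); last by rewrite -conjgM mulVKg.
by have := leads_conj ltO k^-1 lu; rewrite invgK.
Qed.

Lemma sign_posM x y : sign_pos x -> sign_pos y -> sign_pos (x * y).
Proof.
move=> px py.
have [||[no xy]|[u [Dx Dy au lu]]] :=
    product_cases ltO cD nonzero_sub nonzeroJ visited (w := x) (w' := y).
- by move/sign_pos_inert; case=> + _; apply.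
- by move/sign_pos_inert; case=> + _; apply.
- by left.
have value z : [\/ z = x, z = y | z = x * y] -> D (z ^ u) ->
    c (z ^ u) <> 0%Z -> sign_pos z <-> (0 < c (z ^ u))%Z.
  by move=> ez Dz cz; apply: sign_posE; apply: lu.
have ex : (0 <= c (x ^ u))%Z.
  have [->//|cx] := pselect (c (x ^ u) = 0%Z).
  by have /value := cx => /(_ (Or31 _ _ erefl) Dx) [/(_ px) + _]; lia.
have ey : (0 <= c (y ^ u))%Z.
  have [->//|cy] := pselect (c (y ^ u) = 0%Z).
  by have /value := cy => /(_ (Or32 _ _ erefl) Dy) [/(_ py) + _]; lia.
have Dxy : D ((x * y) ^ u) by rewrite conjMg; apply: (convexM cD).
have pxy : (0 < c ((x * y) ^ u))%Z.
  have cxy : c ((x * y) ^ u) = (c (x ^ u) + c (y ^ u))%Z by rewrite conjMg cM.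
  by rewrite cxy; case: au => -[_ ?]; lia.
by apply/value => //; [constructor 3 | lia].
Qed.

Lemma sign_biorder : is_biorder (fun x y => sign_pos (x^-1 * y)).
Proof.
apply: biorder_of_cone; last exact: sign_posJ.
- case=> [[_ /(biorder_irr ltO)]//|[u _]].
  by rewrite conj1g sign_hom1.
- exact: sign_posM.
- exact: sign_pos_total.
Qed.

End SignOrder.

(** The orders given by c and by its opposite disagree on every element that has
    a lead. *)
Lemma sign_orders_differ (K : groupType) (lt : K -> K -> Prop) (D : K -> Prop)
    (c : K -> Z) :
    is_biorder lt -> convex_subgroup lt D ->
    (forall x y, D x -> D y -> c (x * y) = (c x + c y)%Z) ->
    (forall w, exists s : seq K,
      forall u, nonzero D c (w ^ u) -> exists2 p, p \in s & D (p^-1 * u)) ->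
    (exists d, nonzero D c d) ->
  exists P : K -> Prop, [/\ is_biorder (fun x y => P (x^-1 * y)),
    exists x, ~ (P x <-> lt 1 x) &
    forall w, (forall u, ~ nonzero D c (w ^ u)) -> lt 1 w -> P w].
Proof.
move=> ltO cD cM vis [d nd].
pose c' x := (- c x)%Z.
have c'M x y : D x -> D y -> c' (x * y) = (c' x + c' y)%Z.
  by move=> Dx Dy; rewrite /c' cM //; lia.
have nz : nonzero D c' = nonzero D c.
  apply/funext => x; apply: propext; rewrite /nonzero /c'.
  by split=> -[Dx cx]; split=> //; lia.
have vis' := vis; rewrite -nz in vis'.
have [|u lu] := leads_exists ltO cD (nonzeroJ cD cM) vis (w := d) (u := 1).
  by rewrite conjg1.
have lu' := lu; rewrite -nz in lu'.
have e := sign_posE ltO cD cM lu; have e' := sign_posE ltO cD c'M lu'.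
have [same|ne] := pselect (sign_pos lt D c d <-> lt 1 d); last first.
  exists (sign_pos lt D c); split; first exact: sign_biorder.
    by exists d.
  by move=> w no w1; apply/sign_pos_inert.
exists (sign_pos lt D c'); split; first exact: sign_biorder.
  exists d => same'; have [[_ cdu] _] := lu.
  have := iff_trans (iff_sym e) (iff_trans same (iff_trans (iff_sym same') e')).
  by rewrite /c'; lia.
by move=> w; rewrite -nz => no w1; apply/sign_pos_inert.
Qed.

(** * Reordering along a pair of retractions *)

Section SplitOrder.
Variables (K : groupType) (lt : K -> K -> Prop) (D : K -> Prop).
Hypotheses (ltO : is_biorder lt) (cD : convex_subgroup lt D).
Implicit Types (x y z k d u v w : K).

(** Elements on which the comparison along f1 and f2 makes no progress: it would
    lead back to the element itself, up to conjugation. *)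
Definition split_inert (f1 f2 : K -> K) d : Prop :=
  (f1 d = 1 /\ exists k, f2 d = d ^ k) \/ (f2 d = 1 /\ exists k, f1 d = d ^ k).

Definition split_act f1 f2 d : Prop := D d /\ ~ split_inert f1 f2 d.

Variables (f1 f2 : K -> K) (len : K -> nat).

Local Notation inert := (split_inert f1 f2).
Local Notation act := (split_act f1 f2).
Local Notation lead := (leads lt D act).

Definition D_hom (f : K -> K) : Prop :=
  forall x y, D x -> D y -> f (x * y) = f x * f y.

(** The conjugator k is common to x and y because the recursion for a product
    needs f (x ^ u) and f (y ^ u) at the same time; signs are invariant under
    conjugation but len is not. *)
Definition shrinks (f : K -> K) : Prop := forall u x y,
  D (x ^ u) -> D (y ^ u) ->
  [\/ act (x ^ u), act (y ^ u) | act ((x * y) ^ u)] ->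
  exists k, len (f (x ^ u) ^ k) + len (f (y ^ u) ^ k) < len x + len y.

Hypotheses (f1M : D_hom f1) (f2M : D_hom f2).
Hypotheses (f1_len : shrinks f1) (f2_len : shrinks f2).
Hypothesis visited : forall w, exists s : seq K,
  forall u, act (w ^ u) -> exists2 p, p \in s & D (p^-1 * u).

(** The recursion along f1 and f2, as an inductive predicate: its termination is
    only established, by means of shrinks, where totality and closure under
    products are proved. *)
Inductive split_pos : K -> Prop :=
| Split_inert w : (forall u, ~ act (w ^ u)) -> lt 1 w -> split_pos w
| Split_fst w u : lead u w -> split_pos (f1 (w ^ u)) -> split_pos w
| Split_snd w u : lead u w -> f1 (w ^ u) = 1 -> split_pos (f2 (w ^ u)) ->
    split_pos w
| Split_ker w u : lead u w -> f1 (w ^ u) = 1 -> f2 (w ^ u) = 1 -> lt 1 w ->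
    split_pos w.

Definition pos_at u w : Prop :=
  split_pos (f1 (w ^ u)) \/ f1 (w ^ u) = 1 /\
    (split_pos (f2 (w ^ u)) \/ f2 (w ^ u) = 1 /\ lt 1 w).

Lemma D_hom1 f : D_hom f -> f 1 = 1.
Proof.
move=> fM; apply: (mulgI (f 1)).
by rewrite -fM ?mulg1 //; apply: (convex1 cD).
Qed.

Lemma D_homV f d : D_hom f -> D d -> f d^-1 = (f d)^-1.
Proof.
move=> fM Dd; apply/esym/mulg1_eq.
by rewrite -fM ?mulgV ?D_hom1 //; apply: (convexV cD).
Qed.

Lemma D_homJ f k d : D_hom f -> D k -> D d -> f (d ^ k) = f d ^ f k.
Proof.
move=> fM Dk Dd; rewrite !conjgE !fM ?D_homV //.
- exact: (convexV cD).
- exact: (convexM cD).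
Qed.

Lemma act_sub d : act d -> D d. Proof. by case. Qed.

Lemma actJ k d : D k -> act d -> act (d ^ k).
Proof.
have aux f g : D_hom f -> D_hom g -> D k -> D d ->
    f (d ^ k) = 1 /\ (exists h, g (d ^ k) = (d ^ k) ^ h) ->
    f d = 1 /\ exists h, g d = d ^ h.
  move=> fM gM Dk Dd; rewrite !D_homJ // => -[fd [h gd]]; split.
    by apply/eqP; rewrite -(conjg_eq1 _ (f k)) fd.
  exists (k * (h * (g k)^-1)); rewrite !conjgM -gd.
  by rewrite -!conjgM mulgV conjg1.
move=> Dk [Dd ni]; split; first exact/(conj_convex cD).
by case=> [/aux|/aux] /(_ _ _ Dk Dd) id; apply: ni; [left|right]; apply: id.
Qed.

Lemma act1 u : ~ act (1 ^ u).
Proof.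
by case=> _; rewrite conj1g; case; left; rewrite !D_hom1 //; split=> //;
   exists 1; rewrite conj1g.
Qed.

Lemma actV w u : act (w^-1 ^ u) -> act (w ^ u).
Proof.
rewrite conjVg => -[/(convexVE cD) Dw ni]; split=> // i; apply: ni.
case: i => -[e [k ek]]; [left|right]; rewrite !D_homV // e invg1; split=> //;
  by exists k; rewrite ek conjVg.
Qed.

Lemma split_posJ k w : split_pos w -> split_pos (w ^ k).
Proof.
have E z u : (z ^ k) ^ (k^-1 * u) = z ^ u by rewrite -conjgM mulVKg.
have L z u : lead u z -> lead (k^-1 * u) (z ^ k).
  by move/(leads_conj ltO k^-1); rewrite invgK.
case=> {}w.
- move=> no w1; apply: Split_inert; last exact: pos_conj.
  by move=> u; rewrite -conjgM; apply: no.
- by move=> u /L lu p1; apply: (Split_fst lu); rewrite E.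
- by move=> u /L lu e1 p2; apply: (Split_snd lu); rewrite E.
- by move=> u /L lu e1 e2 w1; apply: (Split_ker lu); rewrite ?E //;
    apply: pos_conj.
Qed.

Lemma split_posJE k w : split_pos (w ^ k) -> split_pos w.
Proof. by move/(split_posJ k^-1); rewrite conjgK. Qed.

Lemma split_pos1 w : split_pos w -> w <> 1.
Proof.
have no u : ~ lead u 1 by case=> /act1.
case=> {}w.
- by move=> _ + e; rewrite e => /(biorder_irr ltO).
- by move=> u + _ e; rewrite e => /no.
- by move=> u + _ _ e; rewrite e => /no.
- by move=> u + _ _ _ e; rewrite e => /no.
Qed.

Lemma split_pos_inert w : (forall u, ~ act (w ^ u)) -> split_pos w <-> lt 1 w.
Proof.
move=> no; split=> [p|]; last exact: Split_inert.
case: p no => {}w.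
- by [].
- by move=> u [au _] _ /(_ u).
- by move=> u [au _] _ _ /(_ u).
- by move=> u [au _] _ _ _ /(_ u).
Qed.

Lemma split_pos_lead u w : lead u w -> split_pos w <-> pos_at u w.
Proof.
move=> lu; split; last first.
  case=> [|[e1 [|[e2 w1]]]]; first exact: Split_fst lu.
    exact: (Split_snd lu).
  exact: (Split_ker lu).
have E z v f : lead v z -> lead u z -> D_hom f ->
    f (z ^ u) = f (z ^ v) ^ f (v^-1 * u).
  move=> lv lu' fM; have Duv := leads_same ltO cD lv lu'.
  by rewrite -(D_homJ fM Duv (act_sub lv.1)) -conjgM mulVKg.
move=> p; case: p lu => {}w.
- by move=> no _ [/no].
- move=> v lv p1 lu; left; rewrite (E _ _ _ lv lu) //; exact: split_posJ.
- move=> v lv e1 p2 lu; right; rewrite !(E _ _ _ lv lu) // e1 conj1g.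
  by split=> //; left; apply: split_posJ.
- move=> v lv e1 e2 w1 lu; right; rewrite !(E _ _ _ lv lu) // e1 e2 !conj1g.
  by split=> //; right.
Qed.

(** At a location where w is seen but inert the recursive clause holds trivially.
    In a product it thus applies to both factors, active or not. *)
Lemma pos_at_inert u w : D (w ^ u) -> ~ act (w ^ u) -> split_pos w <-> pos_at u w.
Proof.
move=> Dw na; have {na} : inert (w ^ u) by apply: contrapT => ni; apply: na.
have pE k : split_pos ((w ^ u) ^ k) = split_pos w.
  by apply: propext; rewrite -conjgM; split; [apply: split_posJE | apply: split_posJ].
have w1 k : (w ^ u) ^ k = 1 -> w = 1.
  by rewrite -conjgM => /eqP; rewrite conjg_eq1 => /eqP.
have lt11 : ~ lt 1 1 := @biorder_irr _ _ ltO 1.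
have p11 : ~ split_pos 1 by move/split_pos1.
rewrite /pos_at => -[[-> [k ->]]|[-> [k ->]]]; rewrite pE.
  split; first by right; split=> //; left.
  by case=> // -[_ [//|[/w1 e]]]; rewrite e.
split; first by left.
by case=> // -[/w1 e [//|[_]]]; rewrite e.
Qed.

Lemma split_posM x y : split_pos x -> split_pos y -> split_pos (x * y).
Proof.
move: {2}(len x + len y).+1 (ltnSn (len x + len y)) => n.
elim: n x y => // n IHn x y le_n px py.
have [||[no xy]|[u [Dx Dy au lu]]] :=
    product_cases ltO cD act_sub actJ visited (w := x) (w' := y).
- by move/split_pos_inert; case=> + _; apply.
- by move/split_pos_inert; case=> + _; apply.
- exact: Split_inert.
have at_u z : [\/ z = x, z = y | z = x * y] -> D (z ^ u) ->
    split_pos z = pos_at u z.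
  move=> ez Dz; apply: propext; have [az|az] := pselect (act (z ^ u)).
    exact/split_pos_lead/lu.
  exact: pos_at_inert.
have fM f : shrinks f -> split_pos (f (x ^ u)) -> split_pos (f (y ^ u)) ->
    split_pos (f (x ^ u) * f (y ^ u)).
  move=> /(_ u x y Dx Dy au)[k short] /(split_posJ k) pfx /(split_posJ k) pfy.
  by apply: (@split_posJE k); rewrite conjMg; apply: IHn => //; lia.
have Dxy : D ((x * y) ^ u) by rewrite conjMg; apply: (convexM cD).
rewrite at_u //; last by constructor 3.
move: px py; rewrite (at_u x (Or31 _ _ erefl) Dx) (at_u y (Or32 _ _ erefl) Dy).
rewrite /pos_at conjMg (f1M Dx Dy) (f2M Dx Dy).
move=> [px1|[-> [px2|[-> x1]]]] [py1|[-> [py2|[-> y1]]]]; rewrite ?mulg1 ?mul1g.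
- by left; apply: fM.
- by left.
- by left.
- by left.
- by right; split=> //; left; apply: fM.
- by right; split=> //; left.
- by left.
- by right; split=> //; left.
- by right; split=> //; right; split=> //; apply: (pos_mul ltO).
Qed.

Lemma split_pos_total x : x <> 1 -> split_pos x \/ split_pos x^-1.
Proof.
move: {2}(len x).+1 (ltnSn (len x)) => n.
elim: n x => // n IHn x le_n x1.
have [[u0 au0]|no] := pselect (exists u, act (x ^ u)); last first.
  case: (pos_total ltO x1) => [px|px]; [left|right].
    by apply: Split_inert => // u au; apply: no; exists u.
  by apply: Split_inert => // u /actV au; apply: no; exists u.
have [u lu] := leads_exists ltO cD actJ visited au0.
have [[Dx _] mu] := lu; have [au _] := lu.
have luV : lead u x^-1.
  split; last by move=> v /actV; apply: mu.
  by apply: actV; rewrite invgK.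
have IHf f : D_hom f -> shrinks f -> f (x ^ u) <> 1 ->
    split_pos (f (x ^ u)) \/ split_pos (f (x^-1 ^ u)).
  move=> fM /(_ u x x Dx Dx (Or31 _ _ au))[k short] fx1.
  have /IHn[] : len (f (x ^ u) ^ k) < n by lia.
  - by move/eqP; rewrite conjg_eq1 => /eqP.
  - by move/split_posJE; left.
  by rewrite -conjVg -D_homV // -conjVg => /split_posJE; right.
have [f1x|f1x] := pselect (f1 (x ^ u) = 1); last first.
  by case: (IHf _ f1M f1_len f1x) => p; [left|right];
    [apply: (Split_fst lu) | apply: (Split_fst luV)].
have f1xV : f1 (x^-1 ^ u) = 1 by rewrite conjVg D_homV // f1x invg1.
have [f2x|f2x] := pselect (f2 (x ^ u) = 1); last first.
  by case: (IHf _ f2M f2_len f2x) => p; [left|right];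
    [apply: (Split_snd lu) | apply: (Split_snd luV)].
have f2xV : f2 (x^-1 ^ u) = 1 by rewrite conjVg D_homV // f2x invg1.
by case: (pos_total ltO x1) => p; [left|right];
  [apply: (Split_ker lu) | apply: (Split_ker luV)].
Qed.

Lemma split_biorder : is_biorder (fun x y => split_pos (x^-1 * y)).
Proof.
apply: biorder_of_cone; last exact: split_posJ.
- by move/split_pos1.
- exact: split_posM.
- exact: split_pos_total.
Qed.

End SplitOrder.

Lemma split_inertC (K : groupType) (f1 f2 : K -> K) :
  split_inert f1 f2 = split_inert f2 f1.
Proof.
by apply/funext => d; apply: propext; split=> -[]; by [right|left].
Qed.

(** * Words of a free product *)

Section Words.
Variables G H : groupType.
Local Notation K := (free_prod G H).
Local Notation letter := (G + H)%type.
Implicit Types (a b c : letter) (s t : seq letter) (u v w x y z : K).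

Definition el a : K := FreeProd (reduced_lcons a (isT : reduced [::])).

Definition wprod s : K := foldr (fun a x => el a * x) 1 s.

Definition len x : nat := size (fp_word x).

(** The vertices that the path of the word visits from the identity on. *)
Fixpoint prefixes s : seq K :=
  if s is a :: s' then 1 :: [seq el a * p | p <- prefixes s'] else [:: 1].

Lemma word_el_mul a x : fp_word (el a * x) = lcons a (fp_word x).
Proof. exact: (wmul_lcons a (fp_reduced x) (isT : reduced [::])). Qed.

Lemma wprod_reduced s : reduced s -> fp_word (wprod s) = s.
Proof.
elim: s => //= a s IHs; rewrite reduced_cons => /and3P[a1 fa rs].
by rewrite [LHS]word_el_mul IHs // lcons_fresh // /ocons (negPf a1).
Qed.

Lemma wprod_word x : wprod (fp_word x) = x.
Proof. by apply: val_inj; apply: wprod_reduced; apply: fp_reduced. Qed.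

Lemma wprod_cat s t : wprod (s ++ t) = wprod s * wprod t.
Proof. by elim: s => [|a s IHs] /=; rewrite ?mul1g // IHs mulgA. Qed.

Lemma el1 a : letter1 a -> el a = 1.
Proof. by move=> a1; apply: val_inj; rewrite /= /lcons a1. Qed.

Lemma elM a b c : letterM a b = Some c -> el a * el b = el c.
Proof.
move=> abc; apply: val_inj.
exact: (etrans (word_el_mul a (el b)) (lconsM abc (isT : reduced [::]))).
Qed.

Lemma elV a : el (letterV a) = (el a)^-1.
Proof.
apply/esym/mulg1_eq; case: a => k.
  by rewrite (@elM _ _ (inl 1)) /= ?mulgV // el1 /=.
by rewrite (@elM _ _ (inr 1)) /= ?mulgV // el1 /=.
Qed.

Lemma wprod_neq1 s : reduced s -> s <> [::] -> wprod s <> 1.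
Proof. by move=> rs s0 e; apply: s0; rewrite -(wprod_reduced rs) e. Qed.

Lemma el_neq1 a : ~~ letter1 a -> el a <> 1.
Proof.
move=> a1; rewrite -[el a]mulg1; apply: (@wprod_neq1 [:: a]) => //.
by rewrite reduced_cons a1.
Qed.

Lemma len_wprod s : len (wprod s) <= size s.
Proof.
elim: s => //= a s; rewrite /len word_el_mul => le_s.
apply: (@leq_trans (size (fp_word (wprod s))).+1); last by [].
rewrite /lcons; case: ifP => // _; case: (fp_word _) => //= b t.
by case: letterM => //= c; case: ifP => //=; lia.
Qed.

Lemma reduced_cat a s b t : reduced (a :: s ++ b :: t) =
  [&& reduced (a :: s), alternating (last a s) b & reduced (b :: t)].
Proof.
rewrite /reduced -cat_cons all_cat /= cat_path /=.
by case: (letter1 a); case: (all _ s); case: (letter1 b); case: (all _ t);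
  rewrite /= ?andbF.
Qed.

Lemma reduced_catl s t : reduced (s ++ t) -> reduced s.
Proof.
case: t => [|b t]; first by rewrite cats0.
by case: s => // a s; rewrite cat_cons reduced_cat => /andP[].
Qed.

Lemma reduced_catr s t : reduced (s ++ t) -> reduced t.
Proof.
case: t => // b t; case: s => // a s.
by rewrite cat_cons reduced_cat => /and3P[].
Qed.

Lemma prefixesP s p : p \in prefixes s ->
  exists s1 s2, s = s1 ++ s2 /\ p = wprod s1.
Proof.
elim: s p => [|a s IHs] p /=; first by rewrite inE => /eqP->; exists [::], [::].
rewrite inE => /orP[/eqP->|/mapP[q /IHs[s1 [s2 [-> ->]]] ->]].
  by exists [::], (a :: s).
by exists (a :: s1), s2.
Qed.

Lemma len_conj_prefix w p : p \in prefixes (fp_word w) -> len (w ^ p) <= len w.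
Proof.
move=> /prefixesP[s1 [s2 [e ->]]].
rewrite -{1}(wprod_word w) /(len w) e wprod_cat conjgE mulgA mulKg -wprod_cat.
by apply: leq_trans (len_wprod _) _; rewrite !size_cat addnC.
Qed.

Lemma conj_reduced c a s : reduced (a :: s) -> is_inl (last a s) = is_inl a ->
  alternating c a -> ~~ letter1 c -> reduced (c :: (a :: s) ++ [:: letterV c]).
Proof.
move=> rs las ca c1; rewrite reduced_cons c1 [fresh _ _]ca /=.
rewrite reduced_cat rs reduced_cons letter1V c1 /= andbT.
by rewrite /alternating is_inlV las eq_sym.
Qed.

Lemma conj_wprod c s :
  wprod s ^ (el c)^-1 = wprod (c :: s ++ [:: letterV c]).
Proof. by rewrite /= wprod_cat /= mulg1 elV conjgE invgK mulgA. Qed.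

Hypotheses (G_nontrivial : nontrivial G) (H_nontrivial : nontrivial H).

Lemma other_letter a : exists2 c, ~~ letter1 c & alternating c a.
Proof.
case: G_nontrivial H_nontrivial => g /eqP g1 [h /eqP h1].
by case: a => ?; [exists (inr h) | exists (inl g)].
Qed.

(** A word with first and last letter from the same factor does not commute with
    its conjugate by a letter of the other factor: the two products begin in
    different factors. *)
Lemma odd_word_conj a s : reduced (a :: s) -> is_inl (last a s) = is_inl a ->
  exists k, ~ commute (wprod (a :: s)) (wprod (a :: s) ^ k).
Proof.
move=> rs las; have [c c1 ca] := other_letter a; exists (el c)^-1.
have rc := conj_reduced rs las ca c1.
rewrite conj_wprod /commute -!wprod_cat => /(congr1 (@fp_word G H)).
rewrite !wprod_reduced //.
- by case=> e; rewrite e /alternating eqxx in ca.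
- by rewrite cat_cons reduced_cat rs rc last_cat /= /alternating is_inlV andbT.
- rewrite reduced_cat rs rc /alternating las eq_sym -/(alternating c a).
  by rewrite ca.
Qed.

(** Conjugating by its last letter turns a word whose ends lie in different
    factors into one whose ends lie in the same factor; the doubled letter does
    not vanish because a bi-orderable group is torsion-free. *)
Lemma noncommuting_conj (lt : K -> K -> Prop) x : is_biorder lt -> x <> 1 ->
  exists k l, ~ commute (x ^ k) (x ^ l).
Proof.
move=> ltO; rewrite -(wprod_word x); move: (fp_reduced x).
case: (fp_word x) => // a s rs x1; have [las|las] := eqVneq (is_inl (last a s)) (is_inl a).
  by have [k nc] := odd_word_conj rs las; exists 1, k; rewrite conjg1.
case/lastP: s => [|s b] in rs las x1 *; first by rewrite eqxx in las.
rewrite last_rcons in las; rewrite -cats1 in rs x1 *.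
have [c bbc] := letterM_eq (erefl (is_inl b)); have sc := letterM_side bbc.
move: rs; rewrite reduced_cat => /and3P[ras asb]; rewrite reduced_cons => /andP[b1 _].
have c1 : ~~ letter1 c.
  apply/negP => /el1; rewrite -(elM bbc).
  case: (pos_total ltO (el_neq1 b1)) => p; have := pos_mul ltO p p.
    by move=> + e; rewrite e => /(biorder_irr ltO).
  by rewrite -invgM => + e; rewrite e invg1 => /(biorder_irr ltO).
have rs : reduced (letterV b :: a :: s ++ [:: c]).
  rewrite reduced_cons letter1V b1 reduced_cat ras reduced_cons c1 /= andbT.
  by move: asb; rewrite /alternating is_inlV sc las => ->.
have [|k nc] := odd_word_conj rs; first by rewrite /= last_cat /= sc is_inlV.
exists (el b), (el b * k).
have -> : wprod (a :: s ++ [:: b]) ^ el b = wprod (letterV b :: a :: s ++ [:: c]).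
  by rewrite /= !wprod_cat /= elV conjgE !mulg1 -(elM bbc) !mulgA.
rewrite conjgM; move: nc; congr (~ commute _ (_ ^ k)).
by rewrite /= !wprod_cat /= elV conjgE !mulg1 -(elM bbc) !mulgA.
Qed.

Lemma both_starts g h (P : K -> Prop) x : g <> 1 -> h <> 1 -> x <> 1 ->
    P x -> P x^-1 ->
    (forall c, c = inl g \/ c = inr h -> P (x ^ (el c)^-1)) ->
  forall i, exists a s, [/\ reduced (a :: s), is_inl a = i & P (wprod (a :: s))].
Proof.
move=> g1 h1; rewrite -(wprod_word x); move: (fp_reduced x).
case: (fp_word x) => // a s rs _ Px PxV Pxc i.
have [ai|ai] := eqVneq (is_inl a) i; first by exists a, s.
have [las|las] := eqVneq (is_inl (last a s)) (is_inl a); last first.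
  case/lastP: s => [|s b] in rs Px PxV Pxc las *; first by rewrite eqxx in las.
  rewrite last_rcons in las.
  have e : fp_word (wprod (a :: rcons s b))^-1 = letterV b :: winv (a :: s).
    rewrite [LHS]/(winv (fp_word _)) wprod_reduced // /winv -rcons_cons map_rcons.
    by rewrite rev_rcons.
  exists (letterV b), (winv (a :: s)); rewrite -e fp_reduced wprod_word.
  by split=> //; rewrite is_inlV; move: las ai; case: (is_inl b) (is_inl a) i => [] [] [].
have [c [ec c1 ca]] : exists c,
    [/\ c = inl g \/ c = inr h, ~~ letter1 c & alternating c a].
  case: (a) => ?; [exists (inr h)|exists (inl g)]; split=> //; try exact/eqP.
    by right.
  by left.
exists c, ((a :: s) ++ [:: letterV c]); split.
- exact: conj_reduced.
- by move: ca ai; rewrite /alternating; case: (is_inl c) (is_inl a) i => [] [] [].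
- by rewrite -conj_wprod; apply: Pxc.
Qed.

End Words.

(** * Reading a word along its path *)

Section Scan.
Variables G H : groupType.
Local Notation K := (free_prod G H).
Local Notation letter := (G + H)%type.
Implicit Types (a b c : letter) (s t : seq letter) (u v w x y z : K).

Variables (M : Type) (op : M -> M -> M) (e : M).
Hypotheses (opA : associative op) (op1 : left_id e op).
Variable r : K -> letter -> M.
(* The letter a, read at the vertex v, contributes r v a.  The hypotheses make
   the result independent of the reduction of the word. *)
Hypothesis r1 : forall v a, letter1 a -> r v a = e.
Hypothesis rM : forall v a b c, letterM a b = Some c ->
  op (r v a) (r (v * el a) b) = r v c.

Fixpoint scan v s : M :=
  if s is a :: s' then op (r v a) (scan (v * el a) s') else e.

Definition read v x : M := scan v (fp_word x).

Lemma scan_lcons v a s : scan v (lcons a s) = op (r v a) (scan (v * el a) s).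
Proof.
rewrite /lcons; case: ifP => [a1|_]; first by rewrite (el1 a1) mulg1 r1.
case: s => //= b s; case abc: (letterM a b) => [c|] //.
have vc : v * el c = v * el a * el b by rewrite -mulgA (elM abc).
rewrite opA (rM v abc) -vc.
by case: ifP => c1 //=; rewrite (el1 c1) mulg1 r1.
Qed.

Lemma readM v x y : read v (x * y) = op (read v x) (read (v * x) y).
Proof.
rewrite /read -{2 3}(wprod_word x) [fp_word (x * y)]/(wmul _ _).
rewrite wprod_reduced ?fp_reduced //.
elim: (fp_word x) v => [|a s IHs] v /=; first by rewrite mulg1.
by rewrite scan_lcons IHs opA mulgA.
Qed.

Lemma read_el v a : read v (el a) = op (r v a) e.
Proof. exact: scan_lcons. Qed.

Variable D : K -> Prop.
Hypothesis r_inv : forall d v a, D d -> r (d * v) a = r v a.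

Lemma read_inv d v x : D d -> read (d * v) x = read v x.
Proof.
move=> Dd; rewrite /read; elim: (fp_word x) v => //= a s IHs v.
by rewrite r_inv // -mulgA IHs.
Qed.

Lemma read_hom x y : D x -> read 1 (x * y) = op (read 1 x) (read 1 y).
Proof. by move=> Dx; rewrite readM mul1g -{2}(mulg1 x) read_inv. Qed.

(** Up to D the path of u^-1 and the path of u that follows w are inverse to each
    other, so that only the path of w, started at u^-1, contributes. *)
Lemma read_conj w u : D (w ^ u) ->
  read 1 (w ^ u) = op (op (read 1 u^-1) (read u^-1 w)) (read u^-1 u).
Proof.
move=> Dwu; rewrite conjgE mulgA readM mul1g; congr op; last first.
  by rewrite -[RHS](read_inv _ _ Dwu) conjgE mulgA mulgK.
by rewrite readM mul1g.
Qed.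

Lemma readV u : op (read 1 u^-1) (read u^-1 u) = e.
Proof. by rewrite -{2}(mul1g u^-1) -readM mulVg. Qed.

End Scan.

(** * Crossing numbers *)

Section Crossing.
Variables (G H : groupType) (lt : free_prod G H -> free_prod G H -> Prop).
Local Notation K := (free_prod G H).
Local Notation letter := (G + H)%type.
Implicit Types (a b c : letter) (s t : seq letter) (d u v w x y z : K).
Variable D : K -> Prop.
Hypothesis cD : convex_subgroup lt D.

Lemma D_left d v : D d -> D (d * v) <-> D v.
Proof.
move=> Dd; split; last exact: (convexM cD).
by move/(convexM cD (convexV cD Dd)); rewrite mulKg.
Qed.

Definition ind v : Z := if `[< D v >] then 1%Z else 0%Z.

Lemma ind_inv d v : D d -> ind (d * v) = ind v.
Proof. by move=> Dd; rewrite /ind (asbool_equiv_eq (D_left v Dd)). Qed.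

(** Letters of the second factor count when they leave D, and with the opposite
    sign when they enter D. *)
Definition cross v a : Z :=
  if a is inr _ then (ind v - ind (v * el a)%g)%Z else 0%Z.

Lemma cross1 v a : letter1 a -> cross v a = 0%Z.
Proof. by move=> a1; rewrite /cross el1 // mulg1; case: a {a1} => ?; lia. Qed.

Lemma crossM v a b c : letterM a b = Some c ->
  (cross v a + cross (v * el a)%g b)%Z = cross v c.
Proof.
move=> abc; rewrite /cross -mulgA (elM abc).
case: a b abc => x [] y //= [<-] //.
by move: (ind v) (ind (v * el (inr x))) (ind (v * el (inr (x * y)))) => p q r; lia.
Qed.

Lemma cross_inv d v a : D d -> cross (d * v) a = cross v a.
Proof. by move=> Dd; case: a => // k; rewrite /cross -mulgA !(ind_inv _ Dd). Qed.

Local Notation cread := (read Z.add 0%Z cross).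

Definition crossing x : Z := cread 1 x.

Let addA : associative Z.add := Z.add_assoc.
Let add0 : left_id 0%Z Z.add := Z.add_0_l.

Lemma crossing_hom d x : D d -> crossing (d * x) = (crossing d + crossing x)%Z.
Proof. exact: (read_hom addA add0 cross1 crossM cross_inv). Qed.

Lemma crossing_el v a : crossing (v * el a) = (crossing v + cross v a)%Z.
Proof.
rewrite /crossing (readM addA add0 cross1 crossM) mul1g.
by rewrite (read_el addA add0 cross1 crossM); lia.
Qed.

Lemma crossing_conj w u : D (w ^ u) -> crossing (w ^ u) = cread u^-1 w.
Proof.
move=> Dwu.
rewrite /crossing (read_conj addA add0 cross1 crossM cross_inv Dwu).
by have := readV addA add0 cross1 crossM u; lia.
Qed.

Lemma cread0 v x : (forall p, p \in prefixes (fp_word x) -> ~ D (v * p)) ->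
  cread v x = 0%Z.
Proof.
rewrite /read; elim: (fp_word x) v => //= a s IHs v noD.
have ind0 q : ~ D q -> ind q = 0%Z by rewrite /ind; case: asboolP.
rewrite IHs => [|p ps]; last first.
  by rewrite -mulgA; apply: noD; rewrite inE map_f ?orbT.
have v0 : ind v = 0%Z by apply: ind0; rewrite -(mulg1 v); apply: noD; rewrite mem_head.
have va0 : ind (v * el a) = 0%Z.
  apply: ind0; rewrite -(mulg1 (el a)); apply: noD.
  by rewrite inE map_f ?orbT //; case: (s) => [|? ?]; rewrite mem_head.
by rewrite /cross v0 va0; case: a {noD va0} => _.
Qed.

Lemma crossing_prefix w u : nonzero D crossing (w ^ u) ->
  exists2 p, p \in prefixes (fp_word w) & D (p^-1 * u).
Proof.
move=> [Dwu cwu]; apply: contrapT => no.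
apply: cwu; rewrite crossing_conj //; apply: cread0 => p ps Dp; apply: no.
by exists p => //; apply: (convexVE cD); rewrite invgM invgK.
Qed.

Hypothesis crossing0 : forall d, D d -> crossing d = 0%Z.

(** The side at v of the letters of the first factor (i = true) or of the second
    one (i = false).  They differ at the vertices in D, where a letter of the
    second factor is already across. *)
Definition crossing_side v (i : bool) : bool :=
  (0 <? crossing v + (if i then 0 else ind v))%Z.

Lemma crossing_side_inv d v i : D d -> crossing_side (d * v) i = crossing_side v i.
Proof.
by move=> Dd; rewrite /crossing_side crossing_hom // crossing0 // ind_inv.
Qed.

Lemma crossing_side_el v a :
  crossing_side (v * el a) (is_inl a) = crossing_side v (is_inl a).
Proof.
rewrite /crossing_side crossing_el; case: a => k /=; first by rewrite !Z.add_0_r.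
by congr (_ <? _)%Z; move: (crossing v) (ind v) (ind (v * el (inr k))) => p q r; lia.
Qed.

Lemma crossing_side_off v i j : ~ D v -> crossing_side v i = crossing_side v j.
Proof.
by rewrite /crossing_side /ind; case: asboolP => // _ _; case: i j => [] [].
Qed.

Lemma crossing_side_on v i : D v -> crossing_side v i = ~~ i.
Proof.
move=> Dv; rewrite /crossing_side crossing0 // /ind; case: asboolP => //.
by case: i.
Qed.

End Crossing.

(** * Splitting along the two sides *)

Section Sides.
Variables (G H : groupType) (lt : free_prod G H -> free_prod G H -> Prop).
Local Notation K := (free_prod G H).
Local Notation letter := (G + H)%type.
Implicit Types (a b c : letter) (s t : seq letter) (d u v w x y z : K).
Implicit Types (i j m : bool).
Variable D : K -> Prop.
Hypotheses (ltO : is_biorder lt) (cD : convex_subgroup lt D).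
Variable side : K -> bool -> bool.
(* side v i is the side of the letters of the factor i that start at v.  The two
   sides meet at the vertices in D, and only there. *)
Hypothesis side_inv : forall d v i, D d -> side (d * v) i = side v i.
Hypothesis side_el : forall v a, side (v * el a) (is_inl a) = side v (is_inl a).
Hypothesis side_off : forall v i j, ~ D v -> side v i = side v j.
Hypothesis side_on : forall v i, D v -> side v i = ~~ i.

Definition kept m v a : K := if side v (is_inl a) == m then el a else 1.

Lemma kept1 m v a : letter1 a -> kept m v a = 1.
Proof. by move=> a1; rewrite /kept el1 // if_same. Qed.

Lemma keptM m v a b c : letterM a b = Some c ->
  kept m v a * kept m (v * el a) b = kept m v c.
Proof.
move=> abc; have sab : is_inl a = is_inl b by case: a b abc => ? [].
rewrite /kept (letterM_side abc) -sab side_el.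
by case: ifP => _; rewrite ?mulg1 ?(elM abc).
Qed.

Lemma kept_inv m d v a : D d -> kept m (d * v) a = kept m v a.
Proof. by move=> Dd; rewrite /kept side_inv. Qed.

Definition retr m v x : K := read (@mul K) 1 (kept m) v x.
Definition retr1 m x : K := retr m 1 x.

Let mulA : associative (@mul K) := @mulgA K.
Let mul1 : left_id 1 (@mul K) := @mul1g K.

Lemma retr1_hom m : D_hom D (retr1 m).
Proof.
move=> x y Dx _.
exact: (read_hom mulA mul1 (@kept1 m) (@keptM m) (@kept_inv m) _ Dx).
Qed.

Lemma retr1_conj m w u : D (w ^ u) ->
  retr1 m (w ^ u) = retr m u^-1 w ^ (retr1 m u^-1)^-1.
Proof.
move=> Dwu; rewrite /retr1 /retr.
rewrite (read_conj mulA mul1 (@kept1 m) (@keptM m) (@kept_inv m) Dwu).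
have /mulg1_eq <- := readV mulA mul1 (@kept1 m) (@keptM m) u.
by rewrite conjgE invgK mulgA.
Qed.

Fixpoint count_side m v s : nat :=
  if s is a :: s' then (side v (is_inl a) == m) + count_side m (v * el a) s'
  else 0.

Lemma count_sideC m v s : count_side m v s + count_side (~~ m) v s = size s.
Proof.
elim: s v => //= a s IHs v; rewrite -(IHs (v * el a)).
by case: (side v _); case: m {IHs}; rewrite /=; lia.
Qed.

Lemma count_side_cat m v s t :
  count_side m v (s ++ t) = count_side m v s + count_side m (v * wprod s) t.
Proof.
elim: s v => [|a s IHs] v /=; first by rewrite mulg1.
by rewrite IHs addnA mulgA.
Qed.

Lemma count_side_inv m d v s : D d -> count_side m (d * v) s = count_side m v s.
Proof.
by move=> Dd; elim: s v => //= a s IHs v; rewrite side_inv // -mulgA IHs.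
Qed.

Lemma len_retr m v x : len (retr m v x) <= count_side m v (fp_word x).
Proof.
rewrite /retr /read; elim: (fp_word x) v => //= a s IHs v; rewrite /kept.
case: eqP => _; rewrite ?mul1g //; apply: leq_trans (leq_ltn_trans (IHs _) (ltnSn _)).
set y := scan _ _ _ _ _; rewrite -{1}(wprod_word y).
exact: (len_wprod (a :: fp_word y)).
Qed.

Lemma retr_full m v x : count_side (~~ m) v (fp_word x) = 0 ->
  retr m v x = x /\ retr (~~ m) v x = 1.
Proof.
rewrite -{3}(wprod_word x) /retr /read; elim: (fp_word x) v => //= a s IHs v.
rewrite /kept; case: (side v _) m IHs => [] [] //= IHs /IHs[-> ->];
  by rewrite mul1g.
Qed.

Local Notation act := (split_act D (retr1 true) (retr1 false)).

Lemma actE m : split_act D (retr1 m) (retr1 (~~ m)) = act.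
Proof. by case: m; rewrite // /split_act split_inertC. Qed.

(** Seen from v, the element w moves on side m only.  The conjugator depends on
    m and v alone, which makes the property multiplicative in w. *)
Definition one_sided m v w : Prop :=
  [/\ D (w ^ v), retr1 (~~ m) (w ^ v) = 1 &
      retr1 m (w ^ v) = w ^ (retr1 m v^-1)^-1].

Lemma one_sided_count m v w : D (w ^ v) ->
  count_side (~~ m) v^-1 (fp_word w) = 0 -> one_sided m v w.
Proof.
by move=> Dw /retr_full[e1 e2]; split=> //; rewrite retr1_conj // ?e1 ?e2 ?conj1g.
Qed.

Lemma one_sidedM m v x y :
  one_sided m v x -> one_sided m v y -> one_sided m v (x * y).
Proof.
move=> [Dx x1 xm] [Dy y1 ym]; split; rewrite !conjMg.
- exact: (convexM cD).
- by rewrite retr1_hom // x1 y1 mulg1.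
- by rewrite retr1_hom // xm ym.
Qed.

Lemma one_sidedV m v x : one_sided m v x -> one_sided m v x^-1.
Proof.
move=> [Dx x1 xm]; split; rewrite !conjVg.
- exact: (convexV cD).
- by rewrite (D_homV cD (@retr1_hom _)) // x1 invg1.
- by rewrite (D_homV cD (@retr1_hom _)) // xm.
Qed.

Lemma one_sided_inert m v w : one_sided m v w -> ~ act (w ^ v).
Proof.
rewrite -(actE m) => -[_ w1 wm] [_]; apply; right; split=> //.
by exists (v^-1 * (retr1 m v^-1)^-1); rewrite wm conjgM conjgK.
Qed.

Lemma retr1_shrinks m : shrinks D (retr1 true) (retr1 false) (@len G H) (retr1 m).
Proof.
move=> u x y Dx Dy some_act; exists (retr1 m u^-1).
rewrite !retr1_conj // !conjgKV.
have lenE z : len z = count_side m u^-1 (fp_word z) +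
    count_side (~~ m) u^-1 (fp_word z) by rewrite count_sideC.
have lx := len_retr m u^-1 x; have ly := len_retr m u^-1 y.
have [[x0 y0]|] := pselect (count_side (~~ m) u^-1 (fp_word x) = 0 /\
    count_side (~~ m) u^-1 (fp_word y) = 0).
  have ox := one_sided_count Dx x0; have oy := one_sided_count Dy y0.
  case: some_act => /one_sided_inert no; exfalso; apply: (no m) => //.
  exact: one_sidedM.
rewrite (lenE x) (lenE y); move: (len _) (len _) lx ly => l l'.
by move: (count_side _ _ _) => cx; lia.
Qed.

Lemma count_side_off i v s : (forall p, p \in prefixes s -> ~ D (v * p)) ->
  count_side (~~ side v i) v s = 0.
Proof.
elim: s v i => //= a s IHs v i noD.
have Dv : ~ D v by rewrite -(mulg1 v); apply: noD; rewrite mem_head.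
rewrite (side_off i (is_inl a) Dv) -{3}side_el IHs => [|p ps].
  by case: (side v _).
by rewrite -mulgA; apply: noD; rewrite inE map_f ?orbT.
Qed.

(** If the path of w started at u^-1 avoids D, then it stays on one side. *)
Lemma split_prefix w u : act (w ^ u) ->
  exists2 p, p \in prefixes (fp_word w) & D (p^-1 * u).
Proof.
move=> aw; apply: contrapT => no.
have /one_sided_count : count_side (~~ side u^-1 true) u^-1 (fp_word w) = 0.
  apply: count_side_off => p ps Dp; apply: no; exists p => //.
  by apply: (convexVE cD); rewrite invgM invgK.
by move=> /(_ aw.1)/one_sided_inert.
Qed.

Lemma split_visited w : exists s : seq K, forall u,
  act (w ^ u) -> exists2 p, p \in s & D (p^-1 * u).
Proof. by exists (prefixes (fp_word w)) => u; apply: split_prefix. Qed.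

(** Away from D the path cannot change sides.  The letter after the first return
    comes from the other factor than the letter before it, hence starts on the
    other side. *)
Lemma first_return a s v : reduced (a :: s) -> D (v * wprod (a :: s)) ->
  exists s1 s2, [/\ a :: s = s1 ++ s2, s1 <> [::], D (v * wprod s1),
    count_side (~~ side v (is_inl a)) v s1 = 0 &
    forall b t, s2 = b :: t -> ~~ is_inl b = ~~ side v (is_inl a)].
Proof.
elim: s a v => [|b s IHs] a v rs Dv.
  by exists [:: a], [::]; split=> //=; case: (side v _).
have /and3P[_ ab rbs] : [&& ~~ letter1 a, fresh a (b :: s) & reduced (b :: s)].
  by rewrite -reduced_cons.
have [Dva|Dva] := pselect (D (v * el a)).
  exists [:: a], (b :: s); split=> //=; first by rewrite mulg1.
    by case: (side v _).
  move=> _ _ [<- _]; rewrite -side_el side_on //.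
  by move: ab; rewrite /= /alternating; case: (is_inl a) (is_inl b) => [] [].
have [|s1 [s2 [-> s1n Ds1 cs1 sw]]] := IHs b (v * el a) rbs.
  by rewrite -mulgA.
have e : side (v * el a) (is_inl b) = side v (is_inl a).
  by rewrite (side_off _ (is_inl a)) // side_el.
rewrite e in cs1 sw; exists (a :: s1), s2; split=> //=.
  by rewrite mulgA.
by rewrite cs1; case: (side v _).
Qed.


Local Notation P m := (split_pos lt D (retr1 m) (retr1 (~~ m))).

Lemma split_order m : is_biorder (fun x y => P m (x^-1 * y)).
Proof.
have sh m' : shrinks D (retr1 m) (retr1 (~~ m)) (@len G H) (retr1 m').
  by rewrite /shrinks (actE m); apply: retr1_shrinks.
apply: (split_biorder ltO cD (retr1_hom m) (retr1_hom (~~ m)) (sh m) (sh (~~ m))).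
by rewrite actE; apply: split_visited.
Qed.

Definition loop m x : Prop :=
  [/\ D x, x <> 1, retr1 m x = x & retr1 (~~ m) x = 1].

Lemma loopV m x : loop m x -> loop m x^-1.
Proof.
move=> [Dx x1 xm xn]; split; first exact: (convexV cD).
- by move/eqP; rewrite invg_eq1 => /eqP.
- by rewrite (D_homV cD (retr1_hom m)) ?xm.
- by rewrite (D_homV cD (retr1_hom _)) ?xn ?invg1.
Qed.

Lemma loop_word m s : reduced s -> s <> [::] -> D (wprod s) ->
  count_side (~~ m) 1 s = 0 -> loop m (wprod s).
Proof.
move=> rs s0 Ds; rewrite -{1}(wprod_reduced rs) => /retr_full[e1 e2].
by split=> //; apply: wprod_neq1.
Qed.

Lemma retr1_loops m x y : loop m x -> loop (~~ m) y ->
  retr1 m (x * y) = x /\ retr1 (~~ m) (x * y) = y.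
Proof.
rewrite /loop negbK => -[Dx _ x1 x2] [Dy _ y1 y2].
by rewrite !retr1_hom // x1 x2 y1 y2 mulg1 mul1g.
Qed.

Lemma loops_act m x y : loop m x -> loop (~~ m) y -> act (x * y).
Proof.
move=> lx ly; have [e1 e2] := retr1_loops lx ly; rewrite -(actE m).
case: lx ly => [Dx x1 _ _] [Dy y1 _ _]; split; first exact: (convexM cD).
by rewrite /split_inert e1 e2 => -[[]|[]].
Qed.

(** The first comparison decides as soon as it has a nontrivial outcome. *)
Lemma lead_value m d w k x : leads lt D act d w -> retr1 m (w ^ d) = x ^ k ->
  x <> 1 -> P m w <-> P m x.
Proof.
rewrite -(actE m) => ld e x1.
apply: (iff_trans (split_pos_lead ltO cD (retr1_hom m) (retr1_hom (~~ m)) ld)).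
rewrite /pos_at e; split; last first.
  by left; apply: split_posJ.
case=> [/(split_posJE ltO)//|[/eqP]].
by rewrite conjg_eq1 => /eqP/x1.
Qed.

Lemma loops_value m d x y : D d -> leads lt D act d (x * y) ->
  loop m x -> loop (~~ m) y ->
  (P m (x * y) <-> P m x) /\ (P (~~ m) (x * y) <-> P (~~ m) y).
Proof.
move=> Dd ld lx ly; have [e1 e2] := retr1_loops lx ly.
case: (lx) (ly) => [Dx x1 _ _] [Dy y1 _ _].
have Dxy : D (x * y) := convexM cD Dx Dy.
split; apply: (lead_value ld) => //.
  by rewrite (D_homJ cD (retr1_hom m)) // e1.
by rewrite (D_homJ cD (retr1_hom (~~ m))) // e2.
Qed.

Hypothesis starts : forall i,
  exists a s, [/\ reduced (a :: s), is_inl a = i & D (wprod (a :: s))].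

Lemma loop_exists m : exists x, loop m x.
Proof.
have [a [s [rs ai Ds]]] := starts (~~ m).
have [|s1 [s2 [es s1n Ds1 cs1 _]]] := first_return (v := 1) rs; first by rewrite mul1g.
rewrite mul1g in Ds1; exists (wprod s1); apply: loop_word => //.
  by apply: (@reduced_catl _ _ _ s2); rewrite -es.
by move: cs1; rewrite side_on ?ai ?negbK //; apply: (convex1 cD).
Qed.

Lemma minimal_active : exists w,
  (exists u, act (w ^ u)) /\ forall v, len v < len w -> forall u, ~ act (v ^ u).
Proof.
have [[x lx] [y ly]] := (loop_exists true, loop_exists false).
have : exists u, act ((x * y) ^ u) by exists 1; rewrite conjg1; apply: loops_act lx ly.
move: (x * y) => w; move: {2}(len w).+1 (ltnSn (len w)) => n.
elim: n w => // n IHn w le_n aw.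
have [[v [lv av]]|no] := pselect (exists v, len v < len w /\ exists u, act (v ^ u)).
  by apply: (IHn v) => //; apply: leq_trans lv le_n.
by exists w; split=> // v lv u av; apply: no; exists v; split=> //; exists u.
Qed.

(** First returns to D cut a shortest active element into loops on alternating
    sides.  The product of the first two loops is active, so there are no more. *)
Lemma minimal_loops : exists m d x y,
  [/\ D d, leads lt D act d (x * y), loop m x, loop (~~ m) y &
    exists s1 s2, [/\ reduced (s1 ++ s2), x = wprod s1, y = wprod s2 &
      forall v, len v < size (s1 ++ s2) -> forall u, ~ act (v ^ u)]].
Proof.
have aJ := actJ cD (retr1_hom true) (retr1_hom false).
have [w0 [[u0 au0] min0]] := minimal_active.
have [u lu] := leads_exists ltO cD aJ split_visited au0.
have [p p_w0 Dd] := split_prefix lu.1.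
have := leads_conj ltO p^-1 lu; rewrite invgK.
have := len_conj_prefix p_w0.
move: (p^-1 * u) Dd (w0 ^ p) => d Dd w le_w lead_w {u lu p p_w0 u0 au0}.
have minw v : len v < len w -> forall u, ~ act (v ^ u).
  by move=> lv; apply: min0; apply: leq_trans lv le_w.
have aw : act w.
  by have := aJ _ _ (convexV cD Dd) lead_w.1; rewrite conjgK.
move: aw lead_w minw {w0 min0 le_w}; rewrite -(wprod_word w) /len.
move: (fp_reduced w) => rs; rewrite (wprod_reduced rs); move: rs.
case: (fp_word w) => [_ a1|a s rs aw lead_w minw] {w}.
  by have := act1 cD (retr1_hom true) (retr1_hom false) (u := 1);
    rewrite conjg1; case.
have [|s1 [s2 [es s1n Dx cs1 sw]]] := first_return (v := 1) rs.
  by rewrite mul1g; case: aw.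
rewrite (side_on _ (convex1 cD)) mul1g in Dx cs1 sw.
set m := ~~ is_inl a in cs1 sw.
have rs1 : reduced s1 by apply: (@reduced_catl _ _ _ s2); rewrite -es.
have lx := loop_word rs1 s1n Dx cs1.
case: s2 => [|b t] in es sw *.
  move: aw; rewrite es cats0 -(actE m) => -[_]; case; right.
  by case: lx => _ _ e1 e2; split=> //; exists 1; rewrite conjg1.
have rbt : reduced (b :: t) by apply: (@reduced_catr _ _ s1); rewrite -es.
have [|s3 [s4 [es2 s3n Dxy cs3 _]]] := first_return (v := wprod s1) rbt.
  by rewrite -wprod_cat -es; case: aw.
have Dy : D (wprod s3) by apply/(D_left cD _ Dx).
rewrite (side_on _ Dx) (sw b t erefl) -(mulg1 (wprod s1)) count_side_inv // in cs3.
have rs3 : reduced s3 by apply: (@reduced_catl _ _ _ s4); rewrite -es2.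
have ly := loop_word rs3 s3n Dy cs3.
have es4 : s4 = [::].
  case: s4 es2 => // c s4 es2.
  case: (minw (wprod (s1 ++ s3)) _ 1); last first.
    by rewrite wprod_cat conjg1; apply: loops_act lx ly.
  apply: leq_ltn_trans (len_wprod _) _.
  by rewrite es es2 !size_cat /=; lia.
rewrite es4 cats0 in es2; rewrite es es2 in rs lead_w minw.
exists m, d, (wprod s1), (wprod s3); split=> //; first by rewrite -wprod_cat.
by exists s1, s3.
Qed.

(** With x * y also x^-1 * y has a lead at d.  A higher location where x^-1 * y is
    active would see x * y, but not as active.  As x * y is a shortest active
    element, its whole path from that location would then stay on one side, and
    so would the paths of x, of y and of x^-1 * y.  Now the order P m gives x * y
    and x^-1 * y the signs of x and x^-1, which are opposite, whereas the order
    P (~~ m) gives both of them the sign of y. *)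
Lemma split_orders_differ : exists m x, ~ (P m x <-> lt 1 x).
Proof.
have aJ := actJ cD (retr1_hom true) (retr1_hom false).
have [m [d [x [y [Dd lead_w lx ly [s1 [s2 [rs ex ey minw]]]]]]]] := minimal_loops.
have ew : fp_word (x * y) = s1 ++ s2 by rewrite ex ey -wprod_cat wprod_reduced.
have [Dx x1 _ _] := lx; have [Dy _ _ _] := ly.
have DJ z v : D z -> below lt D d v -> D (z ^ v).
  by move=> Dz /(below_sub ltO cD); apply; apply/(conj_convex cD).
have lead_z : leads lt D act d (x^-1 * y).
  split=> [|v az dv].
    exact/aJ/(loops_act (loopV lx)).
  have [Dxv Dyv] := (DJ _ _ Dx dv, DJ _ _ Dy dv).
  have Dwv : D ((x * y) ^ v) by rewrite conjMg; apply: (convexM cD).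
  have [n [k ek]] : exists n k, retr1 n ((x * y) ^ v) = ((x * y) ^ v) ^ k.
    have : split_inert (retr1 true) (retr1 false) ((x * y) ^ v).
      by apply: contrapT => ni; apply: (lead_w.2 v).
    by case=> -[_ [k ek]]; [exists false, k | exists true, k].
  have n0 : count_side (~~ n) v^-1 (s1 ++ s2) = 0.
    have := count_sideC n v^-1 (s1 ++ s2).
    suff : size (s1 ++ s2) <= count_side n v^-1 (s1 ++ s2) by lia.
    rewrite leqNgt; apply/negP => lt_n.
    have /minw : len (retr n v^-1 (x * y)) < size (s1 ++ s2).
      by apply: leq_ltn_trans lt_n; rewrite -ew; apply: len_retr.
    move: ek; rewrite retr1_conj // => /(congr1 (conjg^~ (retr1 n v^-1))).
    rewrite /= conjgKV -!conjgM => ->; set h := (X in _ ^ X).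
    by move=> /(_ (h^-1 * d)); rewrite -conjgM mulVKg; apply; case: lead_w.
  move: n0; rewrite count_side_cat => /eqP; rewrite addn_eq0 => /andP[/eqP n1 /eqP n2].
  have ox : one_sided n v x.
    apply: one_sided_count => //.
    by rewrite ex wprod_reduced //; apply: reduced_catl rs.
  have oy : one_sided n v y.
    apply: one_sided_count => //; rewrite -(count_side_inv _ _ _ Dxv).
    rewrite ey wprod_reduced ?(reduced_catr rs) //.
    by rewrite conjgE mulgA mulgK ex.
  exact: (one_sided_inert (one_sidedM (one_sidedV ox) oy) az).
apply: contrapT => no.
have same n z : P n z <-> lt 1 z.
  by apply: contrapT => ne; apply: no; exists n, z.
have [e1 e2] := loops_value Dd lead_w lx ly.
have [e3 e4] := loops_value Dd lead_z (loopV lx) ly.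
have {}e1 := iff_trans (iff_sym (same _ _)) (iff_trans e1 (same _ _)).
have {}e2 := iff_trans (iff_sym (same _ _)) (iff_trans e2 (same _ _)).
have {}e3 := iff_trans (iff_sym (same _ _)) (iff_trans e3 (same _ _)).
have {}e4 := iff_trans (iff_sym (same _ _)) (iff_trans e4 (same _ _)).
have no_both : ~ (lt 1 x /\ lt 1 x^-1).
  by case=> p q; have := pos_mul ltO p q; rewrite mulgV => /(biorder_irr ltO).
by have := pos_total ltO x1; tauto.
Qed.

End Sides.

(** * No isolated orders *)

Section Main.
Variables (G H : groupType) (lt : free_prod G H -> free_prod G H -> Prop).
Local Notation K := (free_prod G H).
Implicit Types (d u v w x y z : K).
Hypotheses (G_nontrivial : nontrivial G) (H_nontrivial : nontrivial H).
Hypothesis ltO : is_biorder lt.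

Definition prefix_conjugates (S : seq K) : seq K :=
  [seq s ^ p | s <- S, p <- prefixes (fp_word s)].

(** If s is seen at u, then it is seen at p, where s ^ p would have to be smaller
    than itself. *)
Lemma infinitesimal_inert S s u p : s \in S -> p \in prefixes (fp_word s) ->
    convex_subgroup lt (infinitesimal lt (prefix_conjugates S)) ->
    infinitesimal lt (prefix_conjugates S) (p^-1 * u) ->
  ~ infinitesimal lt (prefix_conjugates S) (s ^ u).
Proof.
move=> sS ps cD Dpu Dsu; apply: (@infinitesimal_notin _ _ ltO (prefix_conjugates S) (s ^ p)).
  by apply/allpairsPdep; exists s, p.
by apply/(conj_convex cD _ Dpu); rewrite -conjgM mulVKg.
Qed.

(** An element that is also infinitesimal for the conjugates of E by a letter of
    each factor remains infinitesimal for E when it is conjugated by the inverse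
    letters, and one of these conjugates begins in the other factor unless the
    inverse does. *)
Lemma infinitesimal_starts E : (forall e, e \in E -> lt 1 e) -> forall i,
  exists a s, [/\ reduced (a :: s), is_inl a = i & infinitesimal lt E (wprod (a :: s))].
Proof.
move=> posE; case: G_nontrivial H_nontrivial => g g1 [h h1].
pose k (c : G + H) := [seq e ^ ((el c)^-1)^-1 | e <- E].
have [|||x x1 small] := @infinitesimal_exists _ _ ltO _ (E ++ k (inl g) ++ k (inr h)).
- by move=> x; apply: (noncommuting_conj G_nontrivial H_nontrivial ltO).
- move=> e; rewrite !mem_cat => /or3P[/posE //|/mapP[f /posE f1 ->]|/mapP[f /posE f1 ->]];
    exact: pos_conj.
- by exists (el (inl g)); apply: el_neq1; apply/eqP.
have cD := infinitesimal_convex ltO posE.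
have Dx : infinitesimal lt E x by move=> e eE; apply: small; rewrite mem_cat eE.
apply: (both_starts g1 h1 x1) => //; first exact: (convexV cD).
by move=> c ec; apply: (infinitesimal_conj ltO) => e eE; apply: small;
  rewrite !mem_cat; case: ec eE => -> ->; rewrite ?orbT.
Qed.

Lemma other_biorder (S : seq K) : {in S, forall k, positive lt k} ->
  exists lt' : K -> K -> Prop,
     [/\ is_biorder lt', ~ same_order lt' lt & {in S, forall k, positive lt' k}].
Proof.
move=> posS; set E := prefix_conjugates S.
have posE e : e \in E -> lt 1 e.
  by move=> /allpairsPdep[s [p [/posS s1 _ ->]]]; apply: pos_conj.
pose D := infinitesimal lt E.
have cD : convex_subgroup lt D := infinitesimal_convex ltO posE.
suff [act [P [PO [x ne] inertP vis]]] : exists (act : K -> Prop) (P : K -> Prop),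
    [/\ is_biorder (fun x y => P (x^-1 * y)), exists x, ~ (P x <-> lt 1 x),
        forall w, (forall u, ~ act (w ^ u)) -> lt 1 w -> P w &
        forall w u, act (w ^ u) -> D (w ^ u) /\
          exists2 p, p \in prefixes (fp_word w) & D (p^-1 * u)].
  exists (fun x y => P (x^-1 * y)); split=> // [same|s sS].
    by apply: ne; have := same 1 x; rewrite invg1 mul1g.
  rewrite /positive invg1 mul1g; apply: inertP; last exact: posS.
  by move=> u /vis[Dsu [p ps Dpu]]; apply: (infinitesimal_inert sS ps cD Dpu Dsu).
have [ex|no] := pselect (exists d, nonzero D (crossing D) d).
  have [||P [PO ne inertP]] := sign_orders_differ ltO cD _ _ ex.
  - by move=> x y Dx _; apply: (crossing_hom cD).
  - by move=> w; exists (prefixes (fp_word w)) => u; apply: (crossing_prefix cD).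
  exists (nonzero D (crossing D)), P; split=> // w u nw.
  by split; [case: nw | apply: (crossing_prefix cD)].
have c0 d : D d -> crossing D d = 0%Z.
  by move=> Dd; apply: contrapT => cd; apply: no; exists d.
have inv := crossing_side_inv cD c0; have elE := crossing_side_el D.
have off := @crossing_side_off _ _ D; have on := crossing_side_on c0.
have [m [x ne]] := split_orders_differ ltO cD inv elE off on (infinitesimal_starts posE).
pose f := retr1 (crossing_side D).
exists (split_act D (f true) (f false)), (split_pos lt D (f m) (f (~~ m))); split.
- exact: split_order.
- by exists x.
- by move=> w no' w1; apply: Split_inert => // u; rewrite /f actE; apply: no'.
- by move=> w u aw; split; [case: aw | apply: (split_prefix cD inv elE off)].
Qed.

End Main.

Theorem theorem1 (G H : groupType)
    (G_nontrivial : nontrivial G) (H_nontrivial : nontrivial H)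
    (G_biorderable : bi_orderable G) (H_biorderable : bi_orderable H) :
  ~ (exists lt : free_prod G H -> free_prod G H -> Prop, isolated_biorder lt) /\
  (forall lt : free_prod G H -> free_prod G H -> Prop, is_biorder lt ->
   forall S : seq (free_prod G H), {in S, forall k, positive lt k} ->
   exists lt' : free_prod G H -> free_prod G H -> Prop,
     [/\ is_biorder lt', ~ same_order lt' lt & {in S, forall k, positive lt' k}]).
Proof.
have other lt ltO S := @other_biorder G H lt G_nontrivial H_nontrivial ltO S.
split=> // -[lt [ltO [S posS only]]].
by have [lt' [ltO' ne posS']] := other lt ltO S posS; apply/ne/only.
Qed.
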